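(* If $G$ is a $2$-connected outerplanar graph with $\Delta(G)=\Delta\geq 4$ and girth $g(G)\geq 4$, then $\chi_{vi,1}(G)\leq \Delta+3$.
   Context: All graphs are finite, simple and undirected. An incidence of $G$ is a pair $(v,e)$ with $v\in V(G)$, $e\in E(G)$, $v\in e$; $I(G)$ is the set of incidences. Let $G^{1/3}$ be obtained from $G$ by replacing each edge $e=\{u,v\}$ by the path $u,(u,e),(v,e),v$. A $vi$-simultaneous proper $k$-coloring of $G$ is a map $c:V(G)\cup I(G)\to\{1,\dots,k\}$ such that any two distinct elements at distance at most $3$ in $G^{1/3}$ receive distinct colors. For a vertex $v$, $I_2(v)=\{(u,\{u,v\}) : u\in N_G(v)\}$. Such a coloring is a $(k,s)$-coloring if for every vertex $v$ at most $s$ distinct colors appear on $I_2(v)$; $\chi_{vi,s}(G)$ is the least such $k$. The girth is the length of a shortest cycle. A graph is outerplanar if it has a planar drawing with all vertices on the outer face. *)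

(* Defs.v *)
From HB Require Import structures.
From mathcomp Require Import all_boot all_order all_algebra.
From mathcomp Require Import all_classical all_reals all_analysis.

Set Implicit Arguments.
Unset Strict Implicit.
Unset Printing Implicit Defensive.

Import Order.TTheory GRing.Theory Num.Theory.
Import numFieldNormedType.Exports.

Record sgraph := SGraph {
  vertex :> finType;
  adj : rel vertex;
  adj_sym : symmetric adj;
  adj_irrefl : irreflexive adj }.

Definition neighbours (G : sgraph) (v : G) : {set G} := [set u | adj v u]%SET.

Definition max_degree (G : sgraph) : nat := \max_(v : G) #|neighbours v|.

Definition edges (G : sgraph) : {set {set G}} :=
  [set e | [exists x, exists y, adj x y && (e == [set x; y])]]%SET.

Definition joined_outside (G : sgraph) (X : {set G}) (x y : G) : bool :=
  connect [rel u v | [&& u \notin X, v \notin X & adj u v]] x y.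

Definition k_connected (k : nat) (G : sgraph) : Prop :=
  k < #|G| /\
  forall X : {set G}, #|X| < k ->
    forall x y : G, x \notin X -> y \notin X -> joined_outside X x y.

Definition is_least (P : nat -> Prop) (n : nat) : Prop :=
  P n /\ forall m, P m -> n <= m.

(* The cycles of the graph are the duplicate-free cyclic sequences of length
   at least 3: [ucycle] alone would also accept [::] and [:: x; y] with [x]
   adjacent to [y]. *)
Definition graph_cycle (G : sgraph) (c : seq G) : Prop :=
  2 < size c /\ ucycle (@adj G) c.

Definition is_girth (G : sgraph) : nat -> Prop :=
  is_least (fun n => exists2 c : seq G, graph_cycle c & size c = n).

Definition dist_le (G : sgraph) (n : nat) (x y : G) : Prop :=
  exists p : seq G, [/\ path (@adj G) x p, last x p = y & size p <= n].

Definition incidence (G : sgraph) : finType :=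
  {p : G * {set G} | (p.2 \in edges G) && (p.1 \in p.2)}.

Definition inc_vertex (G : sgraph) (i : incidence G) : G := (val i).1.
Definition inc_edge (G : sgraph) (i : incidence G) : {set G} := (val i).2.

(* The graph G^{1/3}: an edge e = {u, v} becomes the path u, (u,e), (v,e), v. *)
Definition third_adj (G : sgraph) (x y : G + incidence G) : bool :=
  match x, y with
  | inl _, inl _ => false
  | inl u, inr i => inc_vertex i == u
  | inr i, inl u => inc_vertex i == u
  | inr i, inr j => (inc_edge i == inc_edge j) && (inc_vertex i != inc_vertex j)
  end.

Lemma third_adj_sym (G : sgraph) : symmetric (@third_adj G).
Proof. by move=> [u|i] [v|j] //=; rewrite eq_sym (eq_sym (inc_vertex i)). Qed.

Lemma third_adj_irrefl (G : sgraph) : irreflexive (@third_adj G).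
Proof. by move=> [u|i] //=; rewrite !eqxx. Qed.

Definition third_subdivision (G : sgraph) : sgraph :=
  SGraph (@third_adj_sym G) (@third_adj_irrefl G).

Definition vi_proper (G : sgraph) (k : nat) (c : G + incidence G -> 'I_k) : Prop :=
  forall x y : third_subdivision G, x <> y -> dist_le 3 x y -> c x <> c y.

Definition I2 (G : sgraph) (v : G) : {set incidence G} :=
  [set i | [exists u in neighbours v, val i == (u, [set u; v])]]%SET.

Definition ks_coloring (G : sgraph) (k s : nat) (c : G + incidence G -> 'I_k) : Prop :=
  vi_proper c /\ forall v : G, #|[set c (inr i) | i in I2 v]%SET| <= s.

Definition is_chi_vi (G : sgraph) (s : nat) : nat -> Prop :=
  is_least (fun k => exists c : G + incidence G -> 'I_k, ks_coloring s c).

Local Open Scope classical_set_scope.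
Local Open Scope ring_scope.

(* A drawing in the plane R^2 without crossings. The value of [arc e] matters
   only on [0, 1] and only when [e] is an edge. *)
Record plane_drawing (R : realType) (G : sgraph) := PlaneDrawing {
  pos : G -> R * R;
  arc : {set G} -> R -> R * R;
  pos_inj : injective pos;
  arc_continuous : forall e, e \in edges G ->
    {within `[0, 1], continuous (arc e)};
  arc_inj : forall e, e \in edges G -> {in `[0, 1] &, injective (arc e)};
  arc_ends : forall e, e \in edges G ->
    [set arc e 0; arc e 1] = [set pos v | v in [set` e]];
  arc_avoids_vertices : forall (e : {set G}) (v : G) (t : R), e \in edges G ->
    t \in `]0, 1[ -> arc e t <> pos v;
  arcs_disjoint : forall (e f : {set G}) (s t : R),
    e \in edges G -> f \in edges G -> e <> f ->
    s \in `]0, 1[ -> t \in `]0, 1[ -> arc e s <> arc f t }.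

Definition drawing_set (R : realType) (G : sgraph) (d : plane_drawing R G) :
    set (R * R) :=
  range (pos d) `|` \bigcup_(e in [set` edges G]) (arc d e @` `[0, 1]).

Definition is_face (R : realType) (G : sgraph) (d : plane_drawing R G)
    (F : set (R * R)) : Prop :=
  exists2 p, (~` drawing_set d) p & F = connected_component (~` drawing_set d) p.

(* A vertex lies on a face when it is in the closure of the face. *)
Definition outerplanar (R : realType) (G : sgraph) : Prop :=
  exists d : plane_drawing R G, exists F : set (R * R),
    [/\ is_face d F, ~ bounded_set F & forall v : G, closure F (pos d v)].

(* Main.v *)
Require Import Defs.
From mathcomp Require Import all_boot all_order all_algebra.
From mathcomp Require Import all_classical all_reals all_analysis.
From mathcomp Require Import zify lra.

(** If all incidences in [I2 v] share a colour [d v], a (k,1)-colouring amounts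
    to a proper colouring [c] of G and a proper colouring [d] of its square with
    [c u] different from [d v] for all [v] in the closed neighbourhood of [u].

    Outerplanarity enters only through the absence of a K_{2,3} subdivision. Given
    this, a longest cycle is Hamiltonian, and, G being triangle-free, its chords
    do not cross. A chord [x y] spanning as few vertices as possible cuts off a
    path of at least two vertices of degree 2. Colour the rest by induction; then
    [d] extends greedily, the two ends of the path first (each sees at most
    Delta + 1, resp. Delta + 2, forbidden colours, because [x] and [y] are
    adjacent) and the other vertices afterwards, and finally [c].

    A K_{2,3} subdivision with branch vertex [a] is excluded by mod 2 winding
    numbers of fine chains of points. Cut the three arcs leaving [a] at their last
    visits e1, e2, e3 to a small square around [a], which splits the boundary of
    the square into three arcs. The cycle formed by the outer parts of routes j
    and k and the boundary arc avoiding e_i has the same winding number around [a]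
    as around the neighbour u_i, which is joined to [a] through e_i. Around u_i it
    winds as often as the full cycle formed by routes j and k, and the latter winds
    equally often around u_i and around any point of the face. Summing over the
    three pairs, the routes cancel on both sides, but the boundary of the square
    winds once around [a]. *)

Set Implicit Arguments.
Unset Strict Implicit.
Unset Printing Implicit Defensive.

Section FiniteGraphs.
(* The classical sets imported above shadow the names of [fintype] and [finset]. *)
Import fintype boot.finset.
Local Open Scope set_scope.

(** * Greedy extension of colourings *)

Section GreedyColouring.
Variables (T : finType) (k : nat) (r : rel T).
Hypotheses (r_sym : symmetric r) (r_irrefl : irreflexive r).
Implicit Types (u v w : T) (S M : {set T}) (f : T -> 'I_k).

Definition nbrs_in S v : {set T} := [set w in S | r v w].

Definition proper_on S f := {in S &, forall u v, r u v -> f u <> f v}.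

Lemma nbrs_inS S S' v : S \subset S' -> nbrs_in S v \subset nbrs_in S' v.
Proof. by move=> /subsetP SS'; apply/subsetP => w; rewrite !inE => /andP[/SS' -> ->]. Qed.

Lemma proper_on_extend1 S f v (X : {set 'I_k}) :
  proper_on S f -> v \notin S -> #|X| + #|nbrs_in S v| < k ->
  exists f', [/\ {in S, f' =1 f}, proper_on (v |: S) f' & f' v \notin X].
Proof.
move=> fP vS few.
have [a aP] : exists a, a \notin X :|: f @: nbrs_in S v.
  apply/existsP; rewrite -negb_forall; apply: contraL few => /forallP full.
  rewrite -leqNgt -[k in k <= _]card_ord -cardsT.
  apply: leq_trans (leq_trans (leq_card_setU _ _) _).
    by apply/subset_leq_card/subsetP => a _; exact: full.
  by rewrite leq_add2l leq_imset_card.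
move: aP; rewrite inE negb_or => /andP[aX /imsetP aN].
pose f' w := if w == v then a else f w.
have f'v : f' v = a by rewrite /f' eqxx.
have f'S : {in S, f' =1 f} by move=> w wS; rewrite /f'; case: eqP vS => // <-; rewrite wS.
have aS w : w \in S -> r v w -> a <> f w by move=> wS vw E; apply: aN; exists w; rewrite ?inE ?wS.
exists f'; rewrite f'v; split=> // u w /setU1P[->|uS] /setU1P[->|wS]; rewrite ?r_irrefl //.
- by rewrite f'v f'S //; exact: aS.
- by rewrite f'v f'S // r_sym => /(aS _ uS) /nesym.
- by rewrite !f'S //; exact: fP.
Qed.

Lemma proper_on_extend S M f (X : T -> {set 'I_k}) :
  proper_on S f -> [disjoint S & M] ->
  {in M, forall v, #|X v| + #|nbrs_in (S :|: M) v| < k} ->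
  exists f', [/\ {in S, f' =1 f}, proper_on (S :|: M) f' &
    {in M, forall v, f' v \notin X v}].
Proof.
move=> fP; have [n] := ubnP #|M|; elim: n M => // n IH M Mn SM few.
have [->|[v vM]] := set_0Vmem M.
  by exists f; rewrite setU0; split=> // v; rewrite inE.
have SMv : S :|: M = v |: (S :|: M :\ v) by rewrite setUCA setD1K.
have [|||f1 [f1S f1P f1X]] := IH (M :\ v).
- by move: Mn; rewrite (cardsD1 v) vM.
- by rewrite (disjointWr _ SM) // subD1set.
- move=> w /setD1P[_ wM]; apply: leq_ltn_trans (few w wM).
  by rewrite leq_add2l subset_leq_card ?nbrs_inS // setUS ?subD1set.
have [||f2 [f2S f2P f2v]] := proper_on_extend1 (v := v) (X := X v) f1P.
- by rewrite !inE eqxx orbF (disjointFl SM vM).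
- apply: leq_ltn_trans (few v vM).
  by rewrite leq_add2l subset_leq_card ?nbrs_inS // setUS ?subD1set.
exists f2; rewrite SMv; split=> // w wM.
  by rewrite f2S ?f1S // inE wM.
have [-> //|wv] := eqVneq w v.
by rewrite f2S ?f1X // !inE wv wM ?orbT.
Qed.

End GreedyColouring.

Section Ears.
Variables (G : sgraph) (k : nat).
Implicit Types (u v w x y : G) (S M : {set G}) (c d : G -> 'I_k).

Local Notation nbhd := (nbrs_in (@adj G)).

Lemma leq_card_bigcup (I T : finType) (A : {set I}) (B : I -> {set T}) :
  #|\bigcup_(i in A) B i| <= \sum_(i in A) #|B i|.
Proof.
elim/big_rec2: _ => [|i n C _ IH]; first by rewrite cards0.
by apply: leq_trans (leq_card_setU _ _) _; rewrite leq_add2l.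
Qed.

Definition square_adj S : rel G :=
  fun u v => (u != v) && (adj u v || [exists w in S, adj u w && adj w v]).

Lemma square_adj_sym S : symmetric (square_adj S).
Proof.
move=> u v; rewrite /square_adj eq_sym adj_sym; congr (_ && (_ || _)).
by apply: eq_existsb => w; rewrite (adj_sym u w) (adj_sym w v) (andbC (adj w u)).
Qed.

Lemma square_adj_irrefl S : irreflexive (square_adj S).
Proof. by move=> u; rewrite /square_adj eqxx. Qed.

Lemma square_adjP S u v :
  reflect (u != v /\ (adj u v \/ exists2 w, w \in S & adj u w /\ adj w v)) (square_adj S u v).
Proof.
apply: (iffP andP) => -[uv near_uv]; split=> //.
  by case/orP: near_uv => [|/exists_inP[w wS /andP]]; [left | right; exists w].
by apply/orP; case: near_uv => [|[w wS /andP]]; [left | right; apply/exists_inP; exists w].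
Qed.

Lemma card_square_nbrs S v : v \in S ->
  #|nbrs_in (square_adj S) S v| <= \sum_(w in nbhd S v) #|nbhd S w|.
Proof.
move=> vS; apply: leq_trans (_ : #|\bigcup_(w in nbhd S v) (w |: nbhd S w :\ v)| <= _).
  apply/subset_leq_card/subsetP => w; rewrite inE.
  case/andP=> wS /square_adjP[vw [avw|[z zS [vz zw]]]]; apply/bigcupP.
    by exists w; rewrite !inE ?eqxx ?wS.
  by exists z; rewrite !inE ?zS // wS zw (eq_sym w v) vw orbT.
apply: leq_trans (leq_card_bigcup _ _) _; apply: leq_sum => w.
rewrite inE => /andP[_ vw]; rewrite cardsU1 (cardsD1 v (nbhd S w)) [v \in _]inE vS adj_sym vw.
by rewrite leq_add2r leq_b1.
Qed.

(* [d v] is the common colour of the incidences in [I2 v]. *)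
Definition vi_pair S c d := [/\ {in S, forall u, c u <> d u},
  proper_on (@adj G) S c, proper_on (square_adj S) S d &
  {in S &, forall u v, adj u v -> c u <> d v}].

Lemma vi_pair_rainbow S : 0 < k -> #|S|.*2 <= k -> exists c d, vi_pair S c d.
Proof.
move=> k_gt0 Sk; pose color n : 'I_k := insubd (Ordinal k_gt0) n.
pose c v := color (index v (enum S)); pose d v := color (#|S| + index v (enum S)).
have indexS v : v \in S -> index v (enum S) < #|S| by rewrite cardE index_mem mem_enum.
have cE v : v \in S -> val (c v) = index v (enum S).
  by move=> /indexS vS; rewrite insubdK // unfold_in; lia.
have dE v : v \in S -> val (d v) = #|S| + index v (enum S).
  by move=> /indexS vS; rewrite insubdK // unfold_in; lia.
have rank_inj : {in S &, injective (index^~ (enum S))}.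
  by move=> u v uS vS; apply: (index_inj u); rewrite mem_enum.
have cd u v : u \in S -> v \in S -> c u <> d v.
  by move=> uS vS /(congr1 val); rewrite cE // dE //; have := indexS u uS; lia.
exists c, d; split=> [u uS|u v uS vS uv|u v uS vS uv|u v uS vS _]; do ?exact: cd.
- move=> /(congr1 val); rewrite !cE // => /(rank_inj _ _ uS vS) E.
  by rewrite E adj_irrefl in uv.
- move=> /(congr1 val); rewrite !dE // => /addnI/(rank_inj _ _ uS vS) E.
  by rewrite E square_adj_irrefl in uv.
Qed.

(* [M] collects the inner vertices of a path [x], [v1], ..., [v2], [y] over the chord [x y]. *)
Record ear S M x y v1 v2 : Prop := Ear {
  ear_disjoint : [disjoint S & M];
  ear_chord : [/\ x \in S, y \in S & adj x y];
  ear_ends : [/\ v1 \in M, v2 \in M & v1 != v2];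
  ear_links : adj x v1 /\ adj y v2;
  ear_degree : {in M, forall v, #|nbhd (S :|: M) v| <= 2};
  ear_attached : forall v w, v \in M -> w \in S -> adj v w ->
    v = v1 /\ w = x \/ v = v2 /\ w = y }.

Lemma ear_sym S M x y v1 v2 : ear S M x y v1 v2 -> ear S M y x v2 v1.
Proof.
case=> SM [xS yS xy] [v1M v2M v12] [xv yv] deg att; split=> //.
- by rewrite adj_sym.
- by rewrite eq_sym.
- by move=> v w vM wS /(att v w vM wS)[]; [right | left].
Qed.

Section ExtendOverEar.
Variables (S M : {set G}) (x y v1 v2 : G) (D : nat).
Hypotheses (earSM : ear S M x y v1 v2) (degD : forall v, #|neighbours v| <= D).

Lemma ear_notin v : v \in M -> v \notin S.
Proof. by move=> vM; rewrite (disjointFl (ear_disjoint earSM) vM). Qed.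

Lemma square_adj_ear : {in S &, forall u v, square_adj (S :|: M) u v -> square_adj S u v}.
Proof.
move=> u v uS vS /square_adjP[uv [auv|[w /setUP[wS|wM] [uw wv]]]]; apply/square_adjP; split=> //.
- by left.
- by right; exists w.
have [_ _ v12] := ear_ends earSM.
rewrite adj_sym in uw; move: uv v12.
have [[wE ->]|[wE ->]] := ear_attached earSM wM uS uw;
  by have [[wE' ->]|[wE' ->]] := ear_attached earSM wM vS wv; rewrite -wE -?wE' eqxx.
Qed.

Lemma card_nbrs_ear_chord : #|nbhd S x| < D.
Proof.
have [v1M _ _] := ear_ends earSM; have [xv1 _] := ear_links earSM.
apply: leq_trans (degD x); apply: proper_card; apply/properP; split.
  by apply/subsetP => w; rewrite !inE => /andP[].
by exists v1; rewrite !inE ?xv1 // (negbTE (ear_notin v1M)).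
Qed.

(* The adjacency of [x] and [y] is needed when [v1] and [v2] are adjacent. *)
Lemma square_nbrs_ear_end : nbrs_in (square_adj (S :|: M)) S v1 \subset x |: nbhd S x.
Proof.
have [_ yS xy] := ear_chord earSM; have [v1M _ v12] := ear_ends earSM.
apply/subsetP => w; rewrite !inE => /andP[wS].
case/square_adjP => _ [v1w|[z /setUP[zS|zM] [v1z zw]]].
- by have [[_ ->]|[E _]] := ear_attached earSM v1M wS v1w;
    [rewrite eqxx | rewrite E eqxx in v12].
- have [[_ <-]|[E _]] := ear_attached earSM v1M zS v1z; first by rewrite wS zw orbT.
  by rewrite E eqxx in v12.
by have [[_ ->]|[_ ->]] := ear_attached earSM zM wS zw; rewrite ?eqxx ?yS ?xy ?orbT.
Qed.

Lemma card_square_nbrs_ear_end : #|nbrs_in (square_adj (S :|: M)) S v1| <= D.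
Proof.
apply: leq_trans (subset_leq_card square_nbrs_ear_end) (leq_trans (leq_card_setU _ _) _).
by rewrite cards1 add1n card_nbrs_ear_chord.
Qed.

Lemma card_square_nbrs_ear_inner v : v \in M -> v != v1 -> v != v2 ->
  #|nbrs_in (square_adj (S :|: M)) (S :|: M) v| <= 4.
Proof.
move=> vM vv1 vv2; apply: leq_trans (card_square_nbrs _) _; first by rewrite inE vM orbT.
apply: (@leq_trans (\sum_(w in nbhd (S :|: M) v) 2)).
  apply: leq_sum => w; rewrite !inE => /andP[/orP[wS|wM] vw]; last exact: (ear_degree earSM).
  by have [[E _]|[E _]] := ear_attached earSM vM wS vw; rewrite E eqxx in vv1 vv2.
by rewrite sum_nat_const (leq_mul2r 2 _ 2) (ear_degree earSM).
Qed.

End ExtendOverEar.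

Lemma extend_square_colouring S M x y v1 v2 D d (a1 a2 : 'I_k) :
  ear S M x y v1 v2 -> (forall v, #|neighbours v| <= D) -> 2 < D -> D + 3 <= k ->
  proper_on (square_adj S) S d ->
  exists d', [/\ {in S, d' =1 d}, proper_on (square_adj (S :|: M)) (S :|: M) d',
    d' v1 != a1 & d' v2 != a2].
Proof.
move=> earSM degD D_gt2 Dk dP; pose r := square_adj (S :|: M).
have r_sym : symmetric r := @square_adj_sym _.
have r_irrefl : irreflexive r := @square_adj_irrefl _.
have [v1M v2M v12] := ear_ends earSM.
have SME : v2 |: (v1 |: S) :|: M :\ v1 :\ v2 = S :|: M.
  apply/setP => v; rewrite !inE.
  have [->|] := eqVneq v v1; first by rewrite v1M !orbT.
  by have [->|] := eqVneq v v2; first by rewrite v2M !orbT.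
have dP0 : proper_on r S d by move=> u v uS vS /(square_adj_ear earSM uS vS); exact: dP.
have [||d1 [d1S d1P d1v1]] := proper_on_extend1 r_sym r_irrefl (v := v1) (X := [set a1]) dP0.
- exact: ear_notin earSM _ v1M.
- by have := card_square_nbrs_ear_end earSM degD; rewrite cards1 -/r; lia.
have [||d2 [d2S d2P d2v2]] := proper_on_extend1 r_sym r_irrefl (v := v2) (X := [set a2]) d1P.
- by rewrite !inE negb_or eq_sym v12 (ear_notin earSM).
- have := card_square_nbrs_ear_end (ear_sym earSM) degD; rewrite -/r.
  have : nbrs_in r (v1 |: S) v2 \subset v1 |: nbrs_in r S v2.
    by apply/subsetP => w; rewrite !inE => /andP[/orP[->|->] ->]; rewrite ?orbT.
  move=> /subset_leq_card; rewrite cardsU1 cards1.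
  by case: (_ \notin _); lia.
have [||d3 [d3S d3P _]] := proper_on_extend r_sym r_irrefl
    (M := M :\ v1 :\ v2) (X := fun=> set0) d2P.
- rewrite disjoint_sym disjoint_subset; apply/subsetP => v; rewrite !inE !negb_or.
  by case/and3P=> -> -> /(ear_notin earSM) ->.
- move=> v; rewrite SME => /setD1P[vv2 /setD1P[vv1 vM]]; rewrite cards0 add0n.
  by have := card_square_nbrs_ear_inner earSM vM vv1 vv2; rewrite -/r; lia.
rewrite SME in d3P; exists d3; split=> //.
- by move=> v vS; rewrite d3S ?d2S ?d1S // !inE vS ?orbT.
- rewrite d3S ?d2S ?inE ?eqxx ?orbT //.
  by move: d1v1; rewrite inE.
- by rewrite d3S ?inE ?eqxx //; move: d2v2; rewrite inE.
Qed.

Lemma vi_pair_ear S M x y v1 v2 D c d :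
  ear S M x y v1 v2 -> (forall v, #|neighbours v| <= D) -> 2 < D -> D + 3 <= k ->
  vi_pair S c d -> exists c' d', vi_pair (S :|: M) c' d'.
Proof.
move=> earSM degD D_gt2 Dk [cd cP dP cdN].
have [d' [d'S d'P d'v1 d'v2]] :=
  extend_square_colouring (c x) (c y) earSM degD D_gt2 Dk dP.
have [|c' [c'S c'P c'M]] := proper_on_extend (@adj_sym G) (@adj_irrefl G)
    (X := fun v => d' @: (v |: nbhd (S :|: M) v)) cP (ear_disjoint earSM).
  move=> v vM; have nbrs_le2 := ear_degree earSM vM.
  have colours_le3 : #|d' @: (v |: nbhd (S :|: M) v)| <= 3.
    by apply: leq_trans (leq_imset_card _ _) _; rewrite cardsU1 (leq_add (leq_b1 _)).
  by apply: leq_ltn_trans (leq_add colours_le3 nbrs_le2) _; lia.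
have c'd' u v : u \in M -> v \in u |: nbhd (S :|: M) u -> c' u <> d' v.
  by move=> uM vu E; have /imsetP[] := c'M u uM; exists v.
exists c', d'; split=> //.
- move=> u /setUP[uS|uM]; first by rewrite c'S // d'S //; exact: cd.
  by apply: c'd' => //; exact: setU11.
- move=> u v /setUP[uS|uM] vT uv; last first.
    by apply: c'd' => //; rewrite !inE uv andbT -in_setU vT orbT.
  rewrite c'S //; case/setUP: vT => [vS|vM]; first by rewrite d'S //; exact: cdN.
  by rewrite adj_sym in uv; have [[-> ->]|[-> ->]] := ear_attached earSM vM uS uv;
    apply/eqP; rewrite eq_sym.
Qed.

End Ears.

(** * Cycles with non-crossing chords *)

Lemma subseq_consP (T : eqType) (x : T) (t s : seq T) :
  subseq (x :: t) s <-> exists l1 l2, s = l1 ++ x :: l2 /\ subseq t l2.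
Proof.
split=> [|[l1 [l2 [-> ts]]]].
  elim: s => //= y s IH; case: eqP => [<- ts|_ /IH[l1 [l2 [-> ts]]]].
    by exists [::], s.
  by exists (y :: l1), l2.
by apply: subseq_trans (suffix_subseq l1 _); rewrite /= eqxx.
Qed.

Section Chords.
Variable G : sgraph.
Implicit Types (a b u v w x y z : G) (s m p q l : seq G).

Definition triangle_free := forall a b u, adj a b -> adj b u -> adj a u -> False.

Definition noncrossing s := forall a b u v, subseq [:: a; b; u; v] s ->
  adj a u -> adj b v -> False.

Lemma noncrossing_subseq s s' : subseq s' s -> noncrossing s -> noncrossing s'.
Proof. by move=> ss nc a b u v /subseq_trans/(_ ss); exact: nc. Qed.

Lemma ucycle_shortcut l1 x m y l2 : adj x y ->
  ucycle (@adj G) (l1 ++ x :: m ++ y :: l2) -> ucycle (@adj G) (l1 ++ x :: y :: l2).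
Proof.
move=> xy /andP[cyc us]; apply/andP; split.
  move: cyc; rewrite -(rot_cycle (size l1)) rot_size_cat -[in X in _ -> X](rot_cycle (size l1)).
  by rewrite rot_size_cat /= -catA /= rcons_cat /= cat_path /= xy => /and3P[].
apply: subseq_uniq us; apply: cat_subseq => //=; rewrite eqxx; exact: suffix_subseq.
Qed.

(* The closing edge of a cycle counts as a chord. *)
Definition chord s l1 x m y l2 :=
  [/\ s = l1 ++ x :: m ++ y :: l2, adj x y & 0 < size m].

Definition innermost_chord s l1 x m y l2 := chord s l1 x m y l2 /\
  forall l1' x' m' y' l2', chord s l1' x' m' y' l2' -> size m <= size m'.

Lemma exists_innermost_chord s : 2 < size s -> ucycle (@adj G) s ->
  exists l1 x m y l2, innermost_chord s l1 x m y l2.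
Proof.
move=> s_gt2 /andP[cyc _].
pose P n := `[< exists l1 x m y l2, chord s l1 x m y l2 /\ size m = n >].
have exP : exists n, P n.
  case: s s_gt2 cyc @P => // x s; case/lastP: s => // m y.
  rewrite /= rcons_path last_rcons size_rcons => m_gt0 /andP[_ yx].
  exists (size m); apply/asboolP; exists [::], x, m, y, [::].
  by rewrite /chord cats1 adj_sym; split=> //; split=> //; lia.
have [n /asboolP[l1 [x [m [y [l2 [ch mn]]]]]] nmin] := ex_minnP exP.
exists l1, x, m, y, l2; split=> // l1' x' m' y' l2' ch'.
by rewrite mn; apply: nmin; apply/asboolP; exists l1', x', m', y', l2'.
Qed.

Section InnermostChord.
Variables (s l1 m l2 : seq G) (x y : G).
Hypotheses (innermost : innermost_chord s l1 x m y l2) (s_noncrossing : noncrossing s).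

Let sE : s = l1 ++ x :: m ++ y :: l2. Proof. by have [[]] := innermost. Qed.

Lemma innermost_chord_short l1' x' m' y' l2' : s = l1' ++ x' :: m' ++ y' :: l2' ->
  adj x' y' -> size m' < size m -> m' = [::].
Proof.
move=> sE' xy'; case: m' sE' => // z m' sE'; rewrite ltnNge.
by rewrite (innermost.2 l1' x' (z :: m') y' l2').
Qed.

Lemma innermost_chord_nbr_before m1 v m2 w : m = m1 ++ v :: m2 ->
  w \in x :: m1 -> adj v w -> w = last x m1.
Proof.
move=> mE wx vw; case/splitPr E: {1}(x :: m1) / wx => [p1 p2].
suff p2nil : p2 = [::] by rewrite -[last x m1]/(last x (x :: m1)) E p2nil last_cat.
apply: (@innermost_chord_short (l1 ++ p1) w p2 v (m2 ++ y :: l2)).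
- by rewrite sE mE -!catA /= -cat_cons E -!catA.
- by rewrite adj_sym.
- by have /(congr1 size) := E; rewrite mE !size_cat /=; lia.
Qed.

Lemma innermost_chord_nbr_after m1 v m2 w : m = m1 ++ v :: m2 ->
  w \in rcons m2 y -> adj v w -> w = head y m2.
Proof.
move=> mE wy vw; case/splitPr E: {1}(rcons m2 y) / wy => [p1 p2].
suff p1nil : p1 = [::] by move: E; rewrite p1nil; case: (m2) => [|? ?] /= [].
apply: (@innermost_chord_short (l1 ++ x :: m1) v p1 w (p2 ++ l2)) => //.
- by rewrite sE mE -!catA /= -(cat_rcons y m2) E -!catA.
- by have /(congr1 size) := E; rewrite mE size_rcons !size_cat /=; lia.
Qed.

Lemma innermost_chord_nbr m1 v m2 w : m = m1 ++ v :: m2 -> w \in s -> adj v w ->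
  w = last x m1 \/ w = head y m2.
Proof.
have [[_ xy _] _] := innermost; move=> mE.
have sE' : s = l1 ++ (x :: m1) ++ v :: rcons m2 y ++ l2 by rewrite sE mE cat_rcons -catA.
rewrite {1}sE' mem_cat (mem_cat _ (x :: m1)) (in_cons v) mem_cat => /or4P[wl1|wm1|/eqP wv|wv] vw.
- exfalso; case/splitPr: wl1 sE' => p1 p2 sE'.
  apply: (s_noncrossing (a := w) (b := x) (u := v) (v := y)) xy; last by rewrite adj_sym.
  apply/subseq_consP; exists p1, (p2 ++ (x :: m1) ++ v :: rcons m2 y ++ l2).
  split; first by rewrite sE' -catA.
  apply/subseq_consP; exists p2, (m1 ++ v :: rcons m2 y ++ l2); split=> //.
  apply/subseq_consP; exists m1, (rcons m2 y ++ l2); split=> //.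
  by rewrite sub1seq mem_cat mem_rcons mem_head.
- by left; exact: innermost_chord_nbr_before mE wm1 vw.
- by rewrite wv adj_irrefl in vw.
case/orP: wv => [wm2|wl2]; first by right; exact: innermost_chord_nbr_after mE wm2 vw.
exfalso; apply: (s_noncrossing (a := x) (b := v) (u := y) (v := w)) xy vw.
apply/subseq_consP; exists l1, (m1 ++ v :: rcons m2 y ++ l2); split=> //.
apply/subseq_consP; exists m1, (rcons m2 y ++ l2); split=> //.
by apply/subseq_consP; exists m2, l2; rewrite sub1seq cat_rcons.
Qed.

Hypotheses (s_ucycle : ucycle (@adj G) s) (no_triangle : triangle_free).

Lemma innermost_chord_disjoint z : z \in m -> z \notin l1 ++ x :: y :: l2.
Proof.
move=> zm; have /andP[_] := s_ucycle; rewrite sE.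
rewrite (perm_uniq (_ : perm_eq _ (m ++ (l1 ++ x :: y :: l2)))).
  by rewrite cat_uniq => /and3P[_ /hasPn/(_ z) zN _]; apply: contraL zm => /zN.
by apply/permP => P; rewrite !count_cat /= !count_cat /=; lia.
Qed.

Lemma innermost_chord_path : path (@adj G) x (rcons m y).
Proof.
rewrite rcons_path; have /andP[] := s_ucycle.
rewrite sE -(rot_cycle (size l1)) rot_size_cat /= -catA rcons_cat cat_path /=.
by move=> /and3P[-> ->].
Qed.

Lemma innermost_chord_ends : exists v1 m', [/\ m = v1 :: m', last v1 m' \in m' &
  adj x v1 /\ adj y (last v1 m')].
Proof.
have [[_ xy m_gt0] _] := innermost.
case: m m_gt0 innermost_chord_path => // v1 [|v2 m'] _ /=.
  by move=> /and3P[xv1 v1y _]; case: (no_triangle xv1 v1y xy).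
move=> /andP[xv1]; rewrite -[_ && _]/(path _ v1 (rcons (v2 :: m') y)) rcons_path => /andP[_ v2y].
exists v1, (v2 :: m'); split=> //; first exact: (mem_last v2 m').
by rewrite (adj_sym y).
Qed.

Lemma innermost_chord_vertices :
  [set v in s] = [set v in l1 ++ x :: y :: l2] :|: [set v in m].
Proof.
apply/setP => z; rewrite !inE sE !(mem_cat, inE) /=.
by do !case: (_ == _); do !case: (_ \in _).
Qed.

Lemma innermost_chord_ear : exists v1 v2,
  ear [set v in l1 ++ x :: y :: l2] [set v in m] x y v1 v2.
Proof.
have [v1 [m' [mE v2m' [xv1 yv2]]]] := innermost_chord_ends.
exists v1, (last v1 m'); split.
- rewrite disjoint_sym disjoint_subset; apply/subsetP => z; rewrite !inE.
  exact: innermost_chord_disjoint.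
- by split; rewrite ?inE ?mem_cat ?inE ?eqxx ?orbT //; have [[]] := innermost.
- rewrite !inE mE mem_head inE v2m' orbT; split=> //; apply: contraTneq v2m' => <-.
  have /andP[_] := s_ucycle; rewrite sE cat_uniq mE => /and3P[_ _ /= /and3P[_ + _]].
  by rewrite mem_cat => /norP[].
- by [].
- move=> v; rewrite inE -innermost_chord_vertices => vm; case/splitPr E: {1}m / vm => [p1 p2].
  apply: leq_trans (_ : #|[set last x p1; head y p2]| <= 2); last by rewrite cards2; case: (_ != _).
  apply/subset_leq_card/subsetP => w; rewrite !inE => /andP[ws vw].
  by case: (innermost_chord_nbr E ws vw) => ->; rewrite eqxx ?orbT.
move=> v w; rewrite !inE => vm ws' vw.
have wm : w \notin m by apply: contraL ws' => /innermost_chord_disjoint.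
have ws : w \in s by have /setP/(_ w) := innermost_chord_vertices; rewrite !inE ws' => ->.
case/splitPr E: {1}m / vm => [p1 p2].
case: (innermost_chord_nbr E ws vw) => wE; [left | right].
  case: p1 E wE => [|z p1] E wE; first by move: E; rewrite mE => -[].
  by move: wm; rewrite E wE mem_cat -[last x _]/(last z p1) mem_last.
case: p2 E wE => [|z p2] E wE; last by move: wm; rewrite E wE mem_cat !inE eqxx !orbT.
by have /(congr1 (last x)) := E; rewrite mE last_cat.
Qed.

End InnermostChord.

Lemma vi_pair_noncrossing_cycle D k s : (forall v, #|neighbours v| <= D) -> 2 < D ->
  D + 3 <= k -> triangle_free -> ucycle (@adj G) s -> noncrossing s ->
  exists c d : G -> 'I_k, vi_pair [set v in s] c d.
Proof.
move=> degD D_gt2 Dk no_triangle; have [n] := ubnP (size s).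
elim: n s => // n IH s sn us nc.
have [s_le2|s_gt2] := leqP (size s) 2.
  apply: vi_pair_rainbow; first lia.
  rewrite cardsE; apply: (@leq_trans 4); last by lia.
  by rewrite (leq_double _ 2) (leq_trans (card_size s)).
have [l1 [x [m [y [l2 inner]]]]] := exists_innermost_chord s_gt2 us.
have [[sE xy m_gt0] _] := inner.
have [|||c [d cd]] := IH (l1 ++ x :: y :: l2).
- by move: sn; rewrite sE !size_cat /= size_cat /=; lia.
- by apply: (ucycle_shortcut (m := m) xy); rewrite -sE.
- apply: noncrossing_subseq nc; rewrite sE; apply: cat_subseq => //=.
  by rewrite eqxx; exact: suffix_subseq.
have [v1 [v2 earS]] := innermost_chord_ear inner nc us no_triangle.
by rewrite (innermost_chord_vertices inner); exact: vi_pair_ear earS degD D_gt2 Dk cd.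
Qed.

End Chords.

(** * Hamiltonicity of theta-free graphs *)

Lemma cycle_cat_cons (T : eqType) (e : rel T) (a b : T) (p q : seq T) :
  cycle e (a :: p ++ b :: q) = path e a (rcons p b) && path e b (rcons q a).
Proof. by rewrite /= rcons_cat cat_path /= (rcons_path e a p) andbA. Qed.

Lemma path_rev_rcons (T : eqType) (e : rel T) (a b : T) (p : seq T) :
  symmetric e -> path e b (rcons (rev p) a) = path e a (rcons p b).
Proof.
move=> e_sym; have := rev_path e a (rcons p b).
rewrite last_rcons belast_rcons rev_cons => ->.
by apply: eq_path => x y; rewrite /= e_sym.
Qed.

Section Thetas.
Variable G : sgraph.
Implicit Types (a b u v w x y z : G) (s m p q l : seq G) (A : {pred G}) (X : {set G}).

Lemma path_joined_outside X x p : path (@adj G) x p -> {in x :: p, forall z, z \notin X} ->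
  joined_outside X x (last x p).
Proof.
move=> xp pX; apply/connectP; exists p => //.
elim: p x xp pX => //= y p IH x /andP[xy yp] pX.
rewrite xy !pX ?inE ?eqxx ?orbT //=; apply: IH => // z zp.
by apply: pX; rewrite inE zp orbT.
Qed.

Lemma joined_outside_path X x y : joined_outside X x y -> x \notin X ->
  exists p, [/\ path (@adj G) x p, last x p = y, uniq (x :: p) &
    {in x :: p, forall z, z \notin X}].
Proof.
move=> /connectP[p0 p0P ->] xX; case/shortenP: p0P => p pP up _; exists p; split=> //.
  by apply: sub_path pP => u v /= /and3P[].
elim: p x xX pP {up} => [|z p IH] x xX /=; first by move=> _ z; rewrite inE => /eqP ->.
move=> /andP[/and3P[_ zX _] /IH] /(_ zX) zpX u; rewrite inE => /orP[/eqP -> //|].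
exact: zpX.
Qed.

Definition avoided a (t : 'I_3 -> G) (i : 'I_3) : {set G} := a |: [set t j | j in [set~ i]].

(* The routes from the [t i] to [b] need not be disjoint; if they are, they form
   a K_{2,3} subdivision with branch vertices [a] and [b]. *)
Definition theta a b (t : 'I_3 -> G) :=
  [/\ injective t, forall i, adj a (t i) & forall i, joined_outside (avoided a t i) (t i) b].

Definition theta_free := forall a b t, ~ theta a b t.

Lemma disjoint_paths_theta a b (p : 'I_3 -> seq G) : a != b ->
  (forall i, [/\ p i != [::], a \notin p i, b \notin p i & path (@adj G) a (rcons (p i) b)]) ->
  (forall i j, i != j -> {in p i, forall z, z \notin p j}) ->
  theta a b (fun i => head a (p i)).
Proof.
move=> ab pP disj; have head_in i : head a (p i) \in p i.
  by have [] := pP i; case: (p i) => // *; exact: mem_head.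
split=> [i j E|i|i].
- by apply/eqP; apply: contraT => /disj/(_ _ (head_in i)); rewrite E head_in.
- by have [] := pP i; case: (p i) => //= x q _ _ _ /andP[].
have [pi_neq0 api bpi pathi] := pP i.
have -> : b = last (head a (p i)) (rcons (behead (p i)) b) by rewrite last_rcons.
apply: path_joined_outside; first by case: (p i) pi_neq0 pathi => //= x q _ /andP[].
move=> z; have -> : head a (p i) :: rcons (behead (p i)) b = rcons (p i) b.
  by case: (p i) pi_neq0.
rewrite mem_rcons inE => /orP[/eqP ->|zpi]; apply/setU1P => -[E|/imsetP[j + E]].
- by rewrite E eqxx in ab.
- by move=> _; have [_ _ /negP] := pP j; rewrite E; case.
- by rewrite -E zpi in api.
- by rewrite !inE eq_sym => /disj/(_ _ zpi); rewrite E head_in.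
Qed.

Lemma ucycle_detour_theta a b p q m :
  ucycle (@adj G) (a :: p ++ b :: q) -> p != [::] -> q != [::] -> m != [::] ->
  path (@adj G) a (rcons m b) -> {in m, forall z, z \notin a :: p ++ b :: q} ->
  ~ theta_free.
Proof.
rewrite /ucycle cycle_cat_cons cons_uniq mem_cat in_cons !negb_or cat_uniq /= negb_or.
move=> /andP[/andP[pP qP] /and3P[/and3P[ap ab aq] _ /and3P[/andP[bp /hasPn pq] bq _]]].
move=> p_neq0 q_neq0 m_neq0 mP m_off tf.
pose routes (i : 'I_3) := nth [::] [:: p; rev q; m] i.
have am : a \notin m by apply/negP => /m_off; rewrite mem_head.
have bm : b \notin m by apply/negP => /m_off; rewrite !(inE, mem_cat) eqxx !orbT.
apply: tf (disjoint_paths_theta (p := routes) ab _ _).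
  case=> -[|[|[|//]]] ? /=; split=> //; rewrite ?mem_rev //.
    by rewrite -size_eq0 size_rev size_eq0.
  by rewrite (path_rev_rcons _ _ _ (@adj_sym G)).
have m_offp z : z \in m -> (z \notin p) && (z \notin q).
  by move=> /m_off; rewrite inE mem_cat inE !negb_or => /and4P[_ -> _ ->].
case=> -[|[|[|//]]] ? [[|[|[|//]]] ?] //= _ z; rewrite ?mem_rev.
- by move=> zp; apply/negP => /pq; rewrite zp.
- by move=> zp; apply/negP => /m_offp; rewrite zp.
- exact: pq.
- by move=> zq; apply/negP => /m_offp; rewrite zq andbF.
- by move=> /m_offp/andP[].
- by move=> /m_offp/andP[].
Qed.

Lemma ucycle_detour a b p q m : ucycle (@adj G) (a :: p ++ b :: q) ->
  path (@adj G) a (rcons m b) -> uniq m -> {in m, forall z, z \notin a :: p ++ b :: q} ->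
  ucycle (@adj G) (a :: m ++ b :: q).
Proof.
rewrite /ucycle !cycle_cat_cons => /andP[/andP[_ qP] us] mP um m_off.
apply/andP; split; first by rewrite mP qP.
move: us; rewrite !(cons_uniq a) !mem_cat !negb_or !cat_uniq um.
case/andP=> /andP[_ abq] /and3P[_ _ ubq]; rewrite abq ubq !andbT andTb.
apply/andP; split; first by apply/negP => /m_off; rewrite mem_head.
by apply/hasPn => z zbq; apply/negP => /m_off; rewrite inE mem_cat zbq !orbT.
Qed.

Lemma crossing_chords a b u v p1 p2 p3 p4 : p1 != [::] ->
  ucycle (@adj G) (a :: p1 ++ b :: p2 ++ u :: p3 ++ v :: p4) ->
  adj a u -> adj b v -> ~ theta_free.
Proof.
move=> p1_neq0 us au bv.
have us' : ucycle (@adj G) (a :: p1 ++ b :: v :: p4).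
  by apply: (@ucycle_shortcut _ (a :: p1) b (p2 ++ u :: p3)); rewrite //= -catA.
apply: (ucycle_detour_theta (m := u :: rev p2) us') => //.
  rewrite /= au path_rev_rcons //; last exact: adj_sym.
  move: us => /andP[+ _]; rewrite -[a :: _]/((a :: p1) ++ b :: p2 ++ u :: p3 ++ v :: p4).
  rewrite -(rot_cycle (size (a :: p1))) rot_size_cat -[_ ++ _]/(b :: (p2 ++ _) ++ _) -catA.
  by rewrite cat_cons cycle_cat_cons => /andP[].
have /andP[_] := us.
rewrite (perm_uniq (_ : perm_eq _ ((a :: p1 ++ b :: v :: p4) ++ (u :: rev p2) ++ p3))).
  rewrite cat_uniq => /and3P[_ /hasPn off _] z zm; apply: off.
  by rewrite mem_cat zm.
apply/permP => P; rewrite /= !count_cat /= !count_cat /= count_rev !count_cat /=; lia.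
Qed.

Lemma theta_free_noncrossing s : theta_free -> triangle_free G -> ucycle (@adj G) s ->
  noncrossing s.
Proof.
move=> tf no_triangle us a b u v.
move=> /subseq_consP[l0 [l1 [sE]]] /subseq_consP[p1 [l2 [l1E]]].
move=> /subseq_consP[p2 [l3 [l2E]]] /subseq_consP[p3 [l4 [l3E _]]] au bv.
have {}us : ucycle (@adj G) (a :: p1 ++ b :: p2 ++ u :: p3 ++ v :: (l4 ++ l0)).
  have <- : rot (size l0) s = a :: p1 ++ b :: p2 ++ u :: p3 ++ v :: (l4 ++ l0).
    by rewrite sE rot_size_cat l1E l2E l3E /= -!catA /= -!catA /= -!catA.
  by rewrite /ucycle rot_cycle rot_uniq.
have [p1nil|p1_neq0] := eqVneq p1 [::]; last exact: crossing_chords p1_neq0 us au bv tf.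
move: us; rewrite p1nil /= => us.
have [p2nil|p2_neq0] := eqVneq p2 [::].
  by move: us; rewrite p2nil => /andP[/= /and3P[ab bu _] _]; exact: no_triangle ab bu au.
apply: (@crossing_chords b u v a p2 p3 (l4 ++ l0) [::]) => //; last by rewrite adj_sym.
move: us; rewrite /ucycle -(rot_cycle 1) -(rot_uniq 1) rot1_cons.
by rewrite -!cats1 /= -!catA /= -!catA /= -!catA.
Qed.

Lemma path_enters A x p : path (@adj G) x p -> x \notin A -> last x p \in A ->
  exists p1 b p2, [/\ p = p1 ++ b :: p2, b \in A & {in x :: p1, forall z, z \notin A}].
Proof.
elim: p x => [|y p IH] x /=; first by move=> _ /negbTE ->.
move=> /andP[xy yp] xA lA; have [yA|yA] := boolP (y \in A).
  by exists [::], y, p; split=> // z; rewrite inE => /eqP ->.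
have [p1 [b [p2 [-> bA p1A]]]] := IH y yp yA lA.
exists (y :: p1), b, p2; split=> // z; rewrite inE => /orP[/eqP -> //|].
exact: p1A.
Qed.

Lemma two_connected_detour A w : k_connected 2 G -> 1 < #|A| -> w \notin A ->
  exists a b m, [/\ a \in A, b \in A, a != b & m != [::] /\ uniq m] /\
    path (@adj G) a (rcons m b) /\ {in m, forall z, z \notin A}.
Proof.
move=> [_ conn] A_gt1 wA.
have route X x y : #|X| < 2 -> x \notin X -> y \notin X -> exists p,
    [/\ path (@adj G) x p, last x p = y, uniq (x :: p) & {in x :: p, forall z, z \notin X}].
  by move=> X_lt2 xX yX; exact: joined_outside_path (conn X X_lt2 x y xX yX) xX.
have [x xA] : exists x, x \in A by apply/card_gt0P; exact: ltnW.
have [|||p [pP px _ _]] := route set0 w x; rewrite ?cards0 ?inE //.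
have [|p1 [a [p2 [pE aA p1A]]]] := path_enters pP wA; first by rewrite px.
pose v := last w p1; have vA : v \notin A by apply: p1A; exact: mem_last.
have av : adj a v by rewrite adj_sym; move: pP; rewrite pE cat_path => /and3P[].
have [z zA za] : exists2 z, z \in A & z \notin [set a].
  by apply/subsetPn; apply: contraL A_gt1 => /subset_leq_card; rewrite cards1 -leqNgt.
have va : v \notin [set a] by apply: contraNN vA; rewrite inE => /eqP ->.
have [|q [qP qz uq qa]] := route [set a] v z _ va za; first by rewrite cards1.
have [|m [b [q2 [qE bA mA]]]] := path_enters qP vA; first by rewrite qz.
exists a, b, (v :: m); split; split=> //.
- by have := qa b; rewrite qE !inE mem_cat inE eqxx !orbT eq_sym; apply.
- by split=> //; move: uq; rewrite qE -cat_cons cat_uniq => /andP[].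
- by move: qP; rewrite qE /= av rcons_path cat_path /= => /and3P[-> ->].
Qed.

Lemma exists_longest_cycle : (exists s : seq G, graph_cycle s) ->
  exists2 s : seq G, graph_cycle s & forall s', graph_cycle s' -> size s' <= size s.
Proof.
move=> [s0 s0P]; pose P n := `[< exists2 s : seq G, graph_cycle s & size s = n >].
have exP : exists n, P n by exists (size s0); apply/asboolP; exists s0.
have ubP n : P n -> n <= #|G|.
  by move=> /asboolP[s [_ /andP[_ us]] <-]; rewrite -(card_uniqP us) max_card.
have [n /asboolP[s sP <-] max_s] := ex_maxnP exP ubP.
by exists s => // s' s'P; apply: max_s; apply/asboolP; exists s'.
Qed.

(* A detour off a longest cycle leaves and rejoins it at non-consecutive vertices. *)
Lemma two_connected_hamiltonian : k_connected 2 G -> theta_free ->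
  (exists s : seq G, graph_cycle s) -> exists2 s : seq G, graph_cycle s & forall v, v \in s.
Proof.
move=> conn tf /exists_longest_cycle[s [s_gt2 us] longest].
exists s => // w; apply/negPn/negP => ws.
have [||a [b [m [[a_s bs ab [m_neq0 um]] [mP m_off]]]]] :=
    @two_connected_detour (mem s) w conn.
- by have /andP[_ /card_uniqP ->] := us; exact: ltnW.
- exact: ws.
have [i c rotE] := rot_to a_s.
have size_s : size s = (size c).+1 by rewrite -(size_rot i) rotE.
have sE z : (z \in s) = (z \in a :: c) by rewrite -rotE mem_rot.
have {}us : ucycle (@adj G) (a :: c) by rewrite -rotE /ucycle rot_cycle rot_uniq.
have bc : b \in c by move: bs; rewrite sE inE eq_sym (negbTE ab).
have {}m_off : {in m, forall z, z \notin a :: c} by move=> z /m_off; rewrite sE.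
have m_gt0 : 0 < size m by rewrite lt0n size_eq0.
case/splitPr: bc us m_off size_s => p q us m_off size_s.
have [pnil|p_neq0] := eqVneq p [::].
  have /longest : graph_cycle (a :: m ++ b :: q).
    by split; [rewrite /= size_cat /=; lia | exact: ucycle_detour us mP um m_off].
  by rewrite /= size_s pnil size_cat /=; lia.
have [qnil|q_neq0] := eqVneq q [::]; last first.
  exact: ucycle_detour_theta us p_neq0 q_neq0 m_neq0 mP m_off tf.
have us' : ucycle (@adj G) (b :: [::] ++ a :: p).
  by move: us; rewrite qnil -cat_cons /ucycle -(rot_cycle (size (a :: p)))
    -(rot_uniq (size (a :: p))) rot_size_cat.
have /longest : graph_cycle (b :: rev m ++ a :: p); last first.
  by rewrite /= size_s qnil !size_cat /= size_rev; lia.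
split; first by rewrite /= size_cat size_rev /=; lia.
apply: (ucycle_detour us').
- by rewrite path_rev_rcons //; exact: adj_sym.
- by rewrite rev_uniq.
- by move=> z; rewrite mem_rev => /m_off; rewrite qnil !(inE, mem_cat) orbA orbC.
Qed.

End Thetas.

(** * From pairs of colourings to colourings of vertices and incidences *)

Section Incidences.
Variables (G : sgraph) (k : nat).
Implicit Types (u v w : G) (i j l : incidence G) (c d : G -> 'I_k).

Definition far i : G :=
  odflt (inc_vertex i) [pick w | adj (inc_vertex i) w && (inc_edge i == [set inc_vertex i; w])].

Lemma far_spec i : adj (inc_vertex i) (far i) /\ inc_edge i = [set inc_vertex i; far i].
Proof.
rewrite /far; case: pickP => [w /andP[aw /eqP ew] //|noP]; exfalso.
have /andP[] := valP i; rewrite inE => /existsP[x /existsP[y /andP[xy /eqP eE]]].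
rewrite eE !inE => /orP[] /eqP iE.
  by have := noP y; rewrite /inc_vertex /inc_edge iE xy eE eqxx.
by have := noP x; rewrite /inc_vertex /inc_edge iE adj_sym xy eE setUC eqxx.
Qed.

Lemma adj_far i : adj (inc_vertex i) (far i). Proof. by have [] := far_spec i. Qed.

Lemma incidence_inj i j : inc_vertex i = inc_vertex j -> far i = far j -> i = j.
Proof.
move=> vE fE; apply: val_inj; rewrite [val i]surjective_pairing [val j]surjective_pairing.
congr (_, _) => //; rewrite -/(inc_edge i) -/(inc_edge j).
by rewrite (far_spec i).2 (far_spec j).2 vE fE.
Qed.

Lemma far_eq i w : w \in inc_edge i -> w != inc_vertex i -> far i = w.
Proof. by rewrite (far_spec i).2 !inE => /orP[->|/eqP]. Qed.

Lemma third_adj_far i j : third_adj (inr i) (inr j) -> far i = inc_vertex j /\ far j = inc_vertex i.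
Proof.
move=> /andP[/eqP eE vN].
have ends l : inc_vertex l \in inc_edge l by have /andP[] := valP l.
split; apply: far_eq => //; [by rewrite eE | by rewrite eq_sym | by rewrite -eE].
Qed.

Lemma dist_le_sym (H : sgraph) n (x y : H) : dist_le n x y -> dist_le n y x.
Proof.
case=> p [pP <- pn]; exists (rev (belast x p)); split.
- by rewrite rev_path (eq_path (e' := @adj H)) // => z w; rewrite adj_sym.
- by case: p pP pn => //= z p _ _; rewrite rev_cons last_rcons.
- by rewrite size_rev size_belast.
Qed.

Lemma dist_le3_vertex u (x : third_subdivision G) : dist_le 3 (inl u : third_subdivision G) x ->
  match x with
  | inl v => u = v \/ adj u v
  | inr i => u = inc_vertex i \/ u = far i
  end.
Proof.
case=> p [pP xE pn]; case: p pP xE pn => [|z1 [|z2 [|z3 [|//]]]] /=.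
- by move=> _ <-; left.
- by case: z1 => // i /andP[/eqP <- _] <-; left.
- case: z1 z2 => // i [v|j] /and3P[/eqP <- ij _] <-; first by left; apply/eqP.
  by have [_ ->] := third_adj_far ij; right.
case: z1 z2 z3 => // i [v|j] [w|l] /=; rewrite ?andbF // => /and4P[/eqP <- ij jl _] <-.
- by left; rewrite (eqP ij) (eqP jl).
- by right; rewrite -(eqP jl) -(third_adj_far ij).1 adj_far.
- by left; have [_ <-] := third_adj_far ij; have [] := third_adj_far jl.
Qed.

Lemma dist_le3_incidences i j :
  dist_le 3 (inr i : third_subdivision G) (inr j : third_subdivision G) ->
  inc_vertex i = inc_vertex j \/ adj (far i) (far j).
Proof.
case=> p [pP xE pn]; case: p pP xE pn => [|z1 [|z2 [|z3 [|//]]]] /=.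
- by move=> _ [->]; left.
- move=> + z1E; rewrite z1E andbT => ij; right.
  by rewrite (third_adj_far ij).1 adj_far.
- case: z1 => [v|l] /and3P[il lj _] z2E; rewrite z2E in lj.
    by left; rewrite (eqP il) (eqP lj).
  by left; have [_ <-] := third_adj_far il; have [-> _] := third_adj_far lj.
case: z1 z2 => [v|l] [w|n] /=; rewrite ?andbF // => /and4P[il ln nj _] z3E;
  rewrite z3E in nj; right.
- by have [_ ->] := third_adj_far nj; rewrite (eqP ln) -(eqP il) adj_sym adj_far.
- by have [-> _] := third_adj_far il; rewrite (eqP ln) -(eqP nj) adj_far.
- have [-> _] := third_adj_far il; have [_ <-] := third_adj_far ln.
  by have [-> _] := third_adj_far nj; rewrite adj_far.
Qed.

Lemma vi_pair_coloring c d : vi_pair [set: G] c d ->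
  exists f : G + incidence G -> 'I_k, ks_coloring 1 f.
Proof.
case=> cd cP dP cdN; have inT v : v \in [set: G] by rewrite inE.
pose f (x : G + incidence G) := match x with inl v => c v | inr i => d (far i) end.
have f_vertex u (x : third_subdivision G) :
    dist_le 3 (inl u : third_subdivision G) x -> inl u <> x -> f (inl u) <> f x.
  move=> /dist_le3_vertex; case: x => [v [-> //|uv _]|i [->|->] _]; first exact: cP.
    by apply: cdN => //; exact: adj_far.
  exact: cd.
exists f; split.
  move=> [u|i] y xy dxy; first exact: f_vertex.
  case: y xy dxy => [v|j] xy dxy.
    by move/esym; apply: f_vertex; [exact: dist_le_sym | exact: nesym].
  apply: dP => //; apply/square_adjP; split.
    case/dist_le3_incidences: dxy => [vE|aij].
      by apply/eqP => /(incidence_inj vE) ij; rewrite ij in xy.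
    by apply: contraTneq aij => ->; rewrite adj_irrefl.
  case/dist_le3_incidences: dxy => [vE|]; [right | by left].
  by exists (inc_vertex i); rewrite // adj_sym {2}vE !adj_far.
move=> v; rewrite -(cards1 (d v)); apply/subset_leq_card/subsetP => a.
move=> /imsetP[i + ->]; rewrite [i \in _]inE => /exists_inP[u uv /eqP iE].
rewrite inE /= (@far_eq i v) // /inc_edge /inc_vertex iE ?inE ?eqxx ?orbT //=.
by apply: contraTneq uv => ->; rewrite inE adj_irrefl.
Qed.

End Incidences.

End FiniteGraphs.

(** * Mod 2 winding numbers in the plane *)

Section PlaneTopology.
Import Order.TTheory GRing.Theory Num.Theory.
Import numFieldNormedType.Exports.
Local Open Scope classical_set_scope.
Local Open Scope ring_scope.

Local Notation chain R := (seq ((R * R) * (R * R))%type).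

Lemma connected_equivalence (T : topologicalType) (A : set T) (r : T -> T -> Prop) :
  connected A -> (forall x y, r x y -> r y x) ->
  (forall x y z, r x y -> r y z -> r x z) ->
  (forall x, A x -> nbhs x [set y | A y -> r x y]) ->
  forall x y, A x -> A y -> r x y.
Proof.
move=> cA rsym rtrans rloc x y Ax Ay.
have rxx : r x x by exact: (nbhs_singleton (rloc x Ax)).
pose O (P : set T) := \bigcup_(u in A `&` P) [set w | A w -> r u w]°.
have OO P : open (O P) by apply: bigcup_open => u _; exact: open_interior.
have AO (P : set T) u : A u -> P u -> O P u by move=> Au Pu; exists u => //; exact: rloc.
have rO u w : [set w | A w -> r u w]° w -> A w -> r u w.
  by move=> /interior_subset.
suff : A `&` [set w | r x w] = A by move=> /seteqP[_ /(_ y Ay)[]].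
apply: cA; first by exists x.
- exists (O [set w | r x w]) => //; apply/seteqP; split=> w [Aw].
    by move=> rxw; split=> //; apply: AO.
  by move=> [u [Au rxu] /rO/(_ Aw) ruw]; split=> //=; apply: rtrans rxu ruw.
- exists (~` O [set w | ~ r x w]); first exact: open_closedC.
  apply/seteqP; split=> w [Aw].
    move=> rxw; split=> // -[u [Au nrxu] /rO/(_ Aw) ruw].
    by apply: nrxu; apply: rtrans rxw (rsym _ _ ruw).
  by move=> nO; split=> //=; apply/not_notP => nr; apply: nO; apply: AO.
Qed.

Section Mod2Chains.
Variable R : realType.
Implicit Types (p q z x y : R * R) (E : chain R) (K U : set (R * R)).

(* [p, q] crosses the rightward ray from [z]; this is exact only when [z] lies
   outside the bounding box of [p] and [q]. *)
Definition crosses z p q : bool :=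
  ((p.2 <= z.2) (+) (q.2 <= z.2)) && (z.1 < p.1).

Definition wind E z : bool := \big[addb/false]_(e <- E) crosses z e.1 e.2.

Definition boundary E (F : R * R -> bool) : bool :=
  \big[addb/false]_(e <- E) (F e.1 (+) F e.2).

(* Boundaries are tested against all indicator functions [F], so that chains need
   neither an order nor an orientation. *)
Definition joins E x y := forall F, boundary E F = F x (+) F y.
Definition cyclic_chain E := forall F, boundary E F = false.

Lemma wind_cat E E' z : wind (E ++ E') z = wind E z (+) wind E' z.
Proof. by rewrite /wind big_cat. Qed.

Lemma boundary_cat E E' F : boundary (E ++ E') F = boundary E F (+) boundary E' F.
Proof. by rewrite /boundary big_cat. Qed.

Lemma joins1 x y : joins [:: (x, y)] x y.
Proof. by move=> F; rewrite /boundary big_seq1. Qed.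

Lemma joins_sym E x y : joins E x y -> joins E y x.
Proof. by move=> jE F; rewrite jE addbC. Qed.

Lemma joins_cat E E' x y z : joins E x y -> joins E' y z -> joins (E ++ E') x z.
Proof. by move=> jE jE' F; rewrite boundary_cat jE jE' addbA addbK. Qed.

Lemma joins_cyclic E E' x y : joins E x y -> joins E' x y -> cyclic_chain (E ++ E').
Proof. by move=> jE jE' F; rewrite boundary_cat jE jE' addbb. Qed.

(* Some horizontal or vertical line strictly separates [p], [q] from [z], [z']. *)
Definition apart p q z z' : bool :=
  let sep a b c c' := (Num.max a b < Num.min c c') || (Num.max c c' < Num.min a b) in
  sep p.1 q.1 z.1 z'.1 || sep p.2 q.2 z.2 z'.2.

Lemma crosses_apart p q z z' : apart p q z z' ->
  let F w := ((w.2 <= z.2) (+) (w.2 <= z'.2)) && (z.1 < w.1) in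
  crosses z p q (+) crosses z' p q = F p (+) F q.
Proof.
rewrite /apart /crosses !lt_min !gt_max.
move=> /orP[] /orP[] /andP[/andP[a b] /andP[c d]] /=.
- by rewrite !ltNge !(ltW a, ltW b, ltW c, ltW d) /= !andbF.
- by rewrite a b c !andbT; do 4![case: (_ <= _)].
- by rewrite !(ltW a, ltW b, ltW c, ltW d).
- by rewrite !leNgt a b c d.
Qed.

Lemma wind_apart E z z' : cyclic_chain E ->
  {in E, forall e, apart e.1 e.2 z z'} -> wind E z = wind E z'.
Proof.
move=> cE aE; apply: (@addbI (wind E z')); rewrite addbb addbC.
rewrite -(cE (fun w => ((w.2 <= z.2) (+) (w.2 <= z'.2)) && (z.1 < w.1))).
rewrite /wind /boundary -big_split /= big_seq [RHS]big_seq.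
by apply: eq_bigr => e /aE/crosses_apart.
Qed.

Definition in_bbox p q z : bool :=
  (Num.min p.1 q.1 <= z.1 <= Num.max p.1 q.1) && (Num.min p.2 q.2 <= z.2 <= Num.max p.2 q.2).

Lemma apart_near p q z : ~~ in_bbox p q z -> \forall z' \near z, apart p q z z'.
Proof.
have near_min (f : R * R -> R) b : f @ z --> f z -> b < f z ->
    \forall z' \near z, b < Num.min (f z) (f z').
  by move=> fz bz; near=> z'; rewrite lt_min bz; near: z'; apply: cvgr_gt bz.
have near_max (f : R * R -> R) b : f @ z --> f z -> f z < b ->
    \forall z' \near z, Num.max (f z) (f z') < b.
  by move=> fz bz; near=> z'; rewrite gt_max bz; near: z'; apply: cvgr_lt bz.
rewrite /in_bbox !negb_and -!ltNge => /orP[] /orP[zpq|zpq].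
- by apply: filterS (near_max fst _ cvg_fst zpq) => z' pqz; rewrite /apart pqz orbT.
- by apply: filterS (near_min fst _ cvg_fst zpq) => z' pqz; rewrite /apart pqz.
- by apply: filterS (near_max snd _ cvg_snd zpq) => z' pqz; rewrite /apart pqz !orbT.
- by apply: filterS (near_min snd _ cvg_snd zpq) => z' pqz; rewrite /apart pqz !orbT.
Unshelve. all: by end_near. Qed.

Lemma ball_pairP z w (e : R) : ball z e w <->
  [/\ z.1 - e < w.1, w.1 < z.1 + e, z.2 - e < w.2 & w.2 < z.2 + e].
Proof.
split=> [[]|].
  by rewrite -!ball_normE /= !ltr_norml => /andP[a b] /andP[c d]; split; lra.
move=> [a b c d]; split; rewrite -ball_normE /= ltr_norml; apply/andP; split; lra.
Qed.

Definition fine_in K (eps : R) E :=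
  {in E, forall e, [/\ K e.1, K e.2 & ball e.1 eps e.2]}.

Lemma fine_in_cat K eps E E' : fine_in K eps E -> fine_in K eps E' -> fine_in K eps (E ++ E').
Proof. by move=> fE fE' e; rewrite mem_cat => /orP[/fE|/fE']. Qed.

Lemma fine_inS K K' eps E : K `<=` K' -> fine_in K eps E -> fine_in K' eps E.
Proof. by move=> KK' fE e /fE[/KK' ? /KK' ? ?]. Qed.

Lemma fine_chain K eps x y : connected K -> 0 < eps -> K x -> K y ->
  exists2 E, joins E x y & fine_in K eps E.
Proof.
move=> cK e0; move: x y; apply: connected_equivalence => //.
- by move=> x y [E /joins_sym jE fE]; exists E.
- move=> x y z [E jE fE] [E' jE' fE']; exists (E ++ E'); last exact: fine_in_cat.
  exact: joins_cat jE jE'.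
- move=> x Kx; apply/nbhs_ballP; exists eps => // y xy Ky.
  by exists [:: (x, y)]; [exact: joins1 | move=> e; rewrite inE => /eqP ->].
Qed.

Lemma fine_edge_apart K z (d : R) p q z' : 0 < d -> ball z (d + d) `<=` ~` K ->
  K p -> ball p d q -> ball z d z' -> apart p q z z'.
Proof.
move=> d0 zK Kp /ball_pairP[pq1 pq2 pq3 pq4] /ball_pairP[zz1 zz2 zz3 zz4].
have {zK} : ~ ball z (d + d) p by move=> /zK.
rewrite ball_pairP /apart !lt_min !gt_max => zp.
have [left_p|?] := ltP (z.1 - (d + d)) p.1; last by apply/orP; left; lra.
have [right_p|?] := ltP p.1 (z.1 + (d + d)); last by apply/orP; left; lra.
have [below_p|?] := ltP (z.2 - (d + d)) p.2; last by apply/orP; right; lra.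
have [above_p|?] := ltP p.2 (z.2 + (d + d)); last by apply/orP; right; lra.
by case: zp.
Qed.

(* [E0] is a fixed part of the chain, whose edges may be long. *)
Definition same_wind K E0 z z' := \forall eps \near 0^'+, forall E,
  fine_in K eps E -> cyclic_chain (E0 ++ E) -> wind (E0 ++ E) z = wind (E0 ++ E) z'.

Lemma same_wind_sym K E0 z z' : same_wind K E0 z z' -> same_wind K E0 z' z.
Proof. by apply: filterS => eps zz' E fE cE; rewrite zz'. Qed.

Lemma same_wind_trans K E0 x y z :
  same_wind K E0 x y -> same_wind K E0 y z -> same_wind K E0 x z.
Proof. by apply: filterS2 => eps xy yz E fE cE; rewrite xy ?yz. Qed.

Lemma same_wind_near K E0 z : closed K -> ~ K z ->
  {in E0, forall e, ~~ in_bbox e.1 e.2 z} -> nbhs z (same_wind K E0 z).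
Proof.
move=> clK nKz zE0.
have [d d0 dP] : exists2 d, 0 < d & ball z (d + d) `<=` ~` K.
  have /nbhs_ballP[d /= d0 dP] : nbhs z (~` K).
    by apply: open_nbhs_nbhs; split; [exact: closed_openC|].
  by exists (d / 2); [rewrite divr_gt0 | rewrite -splitr].
have E0_apart : \forall z' \near z, {in E0, forall e, apart e.1 e.2 z z'}.
  elim: E0 zE0 => [|e E0 IH] zE0; first by near=> z' => e.
  have /IH : {in E0, forall f, ~~ in_bbox f.1 f.2 z}.
    by move=> f fE0; rewrite zE0 // inE fE0 orbT.
  apply: filterS2 (apart_near (zE0 e (mem_head _ _))) => z' ze zE0' f.
  by rewrite inE => /orP[/eqP ->|/zE0'].
near=> z'; rewrite /same_wind; near=> eps => E fE cE; apply: wind_apart => // e.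
rewrite mem_cat => /orP[|/fE[Ke1 _ e12]].
  by move: e; near: z'.
apply: (@fine_edge_apart K z d) => //.
  by apply: le_ball e12; near: eps; exact: nbhs_right_le.
by near: z'; exact: nbhsx_ballx.
Unshelve. all: by end_near. Qed.

Lemma same_wind_connected U K E0 : connected U -> closed K -> U `<=` ~` K ->
  (forall z, U z -> {in E0, forall e, ~~ in_bbox e.1 e.2 z}) ->
  forall z z', U z -> U z' -> same_wind K E0 z z'.
Proof.
move=> cU clK UK UE0; apply: connected_equivalence => [//||| z Uz].
- exact: same_wind_sym.
- exact: same_wind_trans.
- by near=> w => _; near: w; exact: same_wind_near (UK z Uz) (UE0 z Uz).
Unshelve. all: by end_near. Qed.

Lemma wind_outside_square (a z : R * R) (r : R) E : cyclic_chain E ->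
  {in E, forall e, ball a r e.1 /\ ball a r e.2} -> ~ ball a r z -> wind E z = false.
Proof.
move=> cE bE /ball_pairP nz.
have [z1|z1] := leP z.1 (a.1 - r).
  rewrite -(cE (fun w => w.2 <= z.2)) /wind /boundary big_seq [RHS]big_seq.
  apply: eq_bigr => e /bE[/ball_pairP[a1 _ _ _] _]; rewrite /crosses.
  by rewrite (le_lt_trans z1 a1) andbT.
rewrite /wind big_seq big1 // => e.
move=> /bE[/ball_pairP[a1 a2 a3 a4] /ball_pairP[b1 b2 b3 b4]]; rewrite /crosses.
have [z2|z2] := ltP z.1 (a.1 + r); last first.
  by rewrite ltNge (ltW (lt_le_trans a2 z2)) andbF.
have [z3|z3] := ltP (a.2 - r) z.2; last first.
  by rewrite !leNgt (le_lt_trans z3 a3) (le_lt_trans z3 b3).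
have [z4|z4] := ltP z.2 (a.2 + r); first by case: nz.
by rewrite (ltW (lt_le_trans a4 z4)) (ltW (lt_le_trans b4 z4)).
Qed.

End Mod2Chains.

(** * Cutting the boundary of a square *)

Lemma eq_pair (S T : Type) (z : S * T) x y : z.1 = x -> z.2 = y -> z = (x, y).
Proof. by case: z => ? ? /= -> ->. Qed.

Section Square.
Variables (R : realType) (a : R * R) (r : R).
Hypothesis r_gt0 : 0 < r.
Implicit Types (s t k : R) (z e : R * R) (E : chain R).

(* Counterclockwise arc length parametrisation on [0, 8 * r], starting at the lower left corner. *)
Definition perimeter t : R * R :=
  if t <= 2 * r then (a.1 - r + t, a.2 - r)
  else if t <= 4 * r then (a.1 + r, a.2 - 3 * r + t)
  else if t <= 6 * r then (a.1 + 5 * r - t, a.2 + r)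
  else (a.1 - r, a.2 + 7 * r - t).

Lemma perimeter_bottom t : t <= 2 * r -> perimeter t = (a.1 - r + t, a.2 - r).
Proof. by rewrite /perimeter => ->. Qed.

Lemma perimeter_right t : 2 * r <= t -> t <= 4 * r -> perimeter t = (a.1 + r, a.2 - 3 * r + t).
Proof. by move=> t2 t4; rewrite /perimeter t4; case: ifP => // t2'; congr (_, _); lra. Qed.

Lemma perimeter_top t : 4 * r <= t -> t <= 6 * r -> perimeter t = (a.1 + 5 * r - t, a.2 + r).
Proof.
have r0 := r_gt0; move=> t4 t6; rewrite /perimeter t6.
by do 2?[case: ifP => ?]; congr (_, _); lra.
Qed.

Lemma perimeter_left t : 6 * r <= t -> perimeter t = (a.1 - r, a.2 + 7 * r - t).
Proof.
have r0 := r_gt0; move=> t6; rewrite /perimeter.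
by do 3?[case: ifP => ?]; congr (_, _); lra.
Qed.

Variant perimeter_spec t : R * R -> Prop :=
| PerimeterBottom of 0 <= t <= 2 * r : perimeter_spec t (a.1 - r + t, a.2 - r)
| PerimeterRight of 2 * r <= t <= 4 * r : perimeter_spec t (a.1 + r, a.2 - 3 * r + t)
| PerimeterTop of 4 * r <= t <= 6 * r : perimeter_spec t (a.1 + 5 * r - t, a.2 + r)
| PerimeterLeft of 6 * r <= t <= 8 * r : perimeter_spec t (a.1 - r, a.2 + 7 * r - t).

Lemma perimeterP t : 0 <= t <= 8 * r -> perimeter_spec t (perimeter t).
Proof.
move=> /andP[t0 t8]; rewrite /perimeter.
have [t2|t2] := leP t (2 * r); first by constructor; lra.
have [t4|t4] := leP t (4 * r); first by constructor; lra.
by have [t6|t6] := leP t (6 * r); constructor; lra.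
Qed.

Lemma perimeter_norm t : 0 <= t <= 8 * r -> `|perimeter t - a| = r.
Proof.
have r0 := r_gt0; move=> /perimeterP[] /andP[t1 t2]; apply/eqP;
  by rewrite eq_le ge_max le_max !ler_norml !ler_normr /=; lra.
Qed.

Lemma perimeter_onto e : `|e - a| = r -> exists2 t, 0 <= t < 8 * r & e = perimeter t.
Proof.
have r0 := r_gt0; move=> /eqP.
rewrite eq_le ge_max le_max !ler_norml !ler_normr /= => ea.
have [e2|e2] := leP e.2 (a.2 - r).
  exists (e.1 - a.1 + r); first by lra.
  by rewrite perimeter_bottom; [apply: eq_pair; lra | lra..].
have [e1|e1] := leP (a.1 + r) e.1.
  exists (e.2 - a.2 + 3 * r); first by lra.
  by rewrite perimeter_right; [apply: eq_pair; lra | lra..].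
have [e2'|e2'] := leP (a.2 + r) e.2.
  exists (a.1 + 5 * r - e.1); first by lra.
  by rewrite perimeter_top; [apply: eq_pair; lra | lra..].
exists (a.2 + 7 * r - e.2); first by lra.
by rewrite perimeter_left; [apply: eq_pair; lra | lra..].
Qed.

Lemma perimeter_inj s t : 0 <= s < 8 * r -> 0 <= t <= 8 * r ->
  perimeter s = perimeter t -> s = t \/ s = 0 /\ t = 8 * r.
Proof.
have r0 := r_gt0; move=> s8 t8; have {s8} [s8 s_lt] : 0 <= s <= 8 * r /\ s < 8 * r by lra.
by case: (perimeterP s8) => hs; case: (perimeterP t8) => ht /pair_equal_spec[x_eq y_eq];
   first [left; lra | right; lra].
Qed.

Definition runs_along E s t :=
  forall f z, f \in E -> in_bbox f.1 f.2 z -> exists2 u, s <= u <= t & z = perimeter u.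

(* The rightward ray from [a] meets the square at parameter [3 * r]. *)
Definition perimeter_arc s t := exists E,
  [/\ joins E (perimeter s) (perimeter t), runs_along E s t &
    wind E a = (s <= 3 * r) (+) (t <= 3 * r)].

Lemma perimeter_arc_trans s t u : s <= t -> t <= u ->
  perimeter_arc s t -> perimeter_arc t u -> perimeter_arc s u.
Proof.
move=> st tu [E [jE bE wE]] [E' [jE' bE' wE']]; exists (E ++ E'); split.
- exact: joins_cat jE jE'.
- move=> f z; rewrite mem_cat => /orP[/bE along /along|/bE' along /along] [k st_k ->];
    by exists k => //; lra.
- by rewrite wind_cat wE wE' addbA addbK.
Qed.

Definition same_side s t := [|| t <= 2 * r, (2 * r <= s) && (t <= 4 * r),
  (4 * r <= s) && (t <= 6 * r) | 6 * r <= s].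

Lemma perimeter_side_onto s t z : 0 <= s -> s <= t -> t <= 8 * r -> same_side s t ->
  in_bbox (perimeter s) (perimeter t) z -> exists2 u, s <= u <= t & z = perimeter u.
Proof.
have r0 := r_gt0; rewrite /in_bbox !ge_min !le_max => s0 st t8 /or4P[side|side|side|side].
- rewrite !perimeter_bottom /=; [|lra..]; exists (z.1 - a.1 + r); first by lra.
  by rewrite perimeter_bottom; [apply: eq_pair|]; lra.
- rewrite !perimeter_right /=; [|lra..]; exists (z.2 - a.2 + 3 * r); first by lra.
  by rewrite perimeter_right; [apply: eq_pair|..]; lra.
- rewrite !perimeter_top /=; [|lra..]; exists (a.1 + 5 * r - z.1); first by lra.
  by rewrite perimeter_top; [apply: eq_pair|..]; lra.
- rewrite !perimeter_left /=; [|lra..]; exists (a.2 + 7 * r - z.2); first by lra.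
  by rewrite perimeter_left; [apply: eq_pair|]; lra.
Qed.

Lemma crosses_perimeter_side s t : 0 <= s -> s <= t -> t <= 8 * r -> same_side s t ->
  crosses a (perimeter s) (perimeter t) = (s <= 3 * r) (+) (t <= 3 * r).
Proof.
have r0 := r_gt0; rewrite /crosses => s0 st t8 /or4P[t2|/andP[s2 t4]|/andP[s4 t6]|s6].
- rewrite !perimeter_bottom; [|lra..]; rewrite addbb.
  by have [-> ->] : s <= 3 * r /\ t <= 3 * r by lra.
- rewrite !perimeter_right /=; [|lra..]; rewrite ltrDl r_gt0 andbT.
  by congr (_ (+) _); apply/idP/idP; lra.
- rewrite !perimeter_top; [|lra..]; rewrite addbb.
  by have [/lt_geF -> /lt_geF ->] : 3 * r < s /\ 3 * r < t by lra.
- rewrite !perimeter_left /=; [|lra..]; rewrite ltrDl oppr_gt0 ltNge (ltW r_gt0) andbF.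
  by have [/lt_geF -> /lt_geF ->] : 3 * r < s /\ 3 * r < t by lra.
Qed.

Lemma perimeter_arc_side s t : 0 <= s -> s <= t -> t <= 8 * r -> same_side s t ->
  perimeter_arc s t.
Proof.
move=> s0 st t8 side; exists [:: (perimeter s, perimeter t)]; split.
- exact: joins1.
- by move=> f z; rewrite inE => /eqP -> /=; exact: perimeter_side_onto.
- by rewrite /wind big_seq1 crosses_perimeter_side.
Qed.

Lemma perimeter_arc_cut lo c hi :
  (forall s t, lo <= s -> s <= t -> t <= c -> perimeter_arc s t) ->
  (forall s t, c <= s -> s <= t -> t <= hi -> perimeter_arc s t) ->
  forall s t, lo <= s -> s <= t -> t <= hi -> perimeter_arc s t.
Proof.
move=> below above s t los st thi; have [tc|ct] := leP t c; first exact: below.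
have [cs|sc] := leP c s; first exact: above.
by apply: (perimeter_arc_trans (ltW sc) (ltW ct)); [apply: below | apply: above]; lra.
Qed.

Lemma perimeter_arcP s t : 0 <= s -> s <= t -> t <= 8 * r -> perimeter_arc s t.
Proof.
have r0 := r_gt0; move: s t; apply: (@perimeter_arc_cut _ (4 * r));
  [apply: (@perimeter_arc_cut _ (2 * r)) | apply: (@perimeter_arc_cut _ (6 * r))] => s t ls st th;
  apply: perimeter_arc_side; rewrite ?/same_side; lra.
Qed.

Definition on_square_off E e :=
  forall f z, f \in E -> in_bbox f.1 f.2 z -> `|z - a| = r /\ z <> e.

Lemma perimeter_arc_off s t k E : 0 <= s -> t <= 8 * r -> 0 <= k < 8 * r ->
  (forall u, s <= u <= t -> u <> k /\ (k = 0 -> u <> 8 * r)) ->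
  runs_along E s t -> on_square_off E (perimeter k).
Proof.
move=> s0 t8 k8 uk bE f z /bE along /along[u u_st ->]; have [nuk nu8] := uk u u_st.
split; first by apply: perimeter_norm; lra.
by move=> /esym/(perimeter_inj k8)[|/esym|[]]; [lra | exact: nuk | exact: nu8].
Qed.

(* [(s < k) (+) (t < k)] says that [k] lies between [s] and [t], so that the chain
   has to go the other way round. *)
Lemma perimeter_route s t k : 0 <= s < 8 * r -> 0 <= t < 8 * r -> 0 <= k < 8 * r ->
  s != k -> t != k ->
  exists A, [/\ joins A (perimeter s) (perimeter t), on_square_off A (perimeter k) &
    wind A a = (s <= 3 * r) (+) (t <= 3 * r) (+) ((s < k) (+) (t < k))].
Proof.
have r0 := r_gt0; wlog st : s t / s <= t => [th s8 t8 k8 sk tk|s8 t8 k8 sk tk].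
  have [st|/ltW ts] := leP s t; first exact: th.
  have [A [/joins_sym jA offA wA]] := th t s ts t8 s8 k8 tk sk; exists A; split=> //.
  by rewrite wA (addbC (t <= _)) (addbC (t < k)).
have [/andP[s_k k_t]|not_between] := boolP (s < k < t).
  have [A [jA bA wA]] : perimeter_arc t (8 * r) by apply: perimeter_arcP; lra.
  have [A' [jA' bA' wA']] : perimeter_arc 0 s by apply: perimeter_arcP; lra.
  exists (A ++ A'); split.
  - apply: joins_sym; apply: (joins_cat jA); suff -> : perimeter (8 * r) = perimeter 0 by [].
    by rewrite perimeter_left ?perimeter_bottom; [congr (_, _); lra | lra..].
  - have offA : on_square_off A (perimeter k).
      by apply: perimeter_arc_off bA => [|//|//|u u_t]; [lra | split=> *; lra].
    have offA' : on_square_off A' (perimeter k).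
      by apply: perimeter_arc_off bA' => [//||//|u u_s]; [lra | split=> *; lra].
    by move=> f z; rewrite mem_cat => /orP[/offA|/offA']; apply.
  - rewrite wind_cat wA wA' s_k (ltNge t) (ltW k_t) (_ : 0 <= 3 * r); last by lra.
    rewrite (_ : 8 * r <= 3 * r = false); last by apply/negbTE; lra.
    by case: (s <= _); case: (t <= _).
have [A [jA bA wA]] : perimeter_arc s t by apply: perimeter_arcP; lra.
exists A; split=> //.
  by apply: perimeter_arc_off bA => [||//|u u_st]; [lra | lra | split=> *; lra].
rewrite wA (_ : (s < k) = (t < k)) ?addbb ?addbF //.
by apply/idP/idP; lra.
Qed.

Lemma addb_sum_ordS n (f : 'I_n -> bool) :
  \big[addb/false]_(i < n) (f (ordS i) (+) f (ordS (ordS i))) = false.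
Proof.
by rewrite big_split /= [X in X (+) _](reindex_inj (@ordS_inj n)) /= addbb.
Qed.

(* Three points cut the square into three arcs; [A i] is the one opposite to [e i]. *)
Lemma square_cut (e : 'I_3 -> R * R) : injective e -> (forall i, `|e i - a| = r) ->
  exists A : 'I_3 -> chain R,
    (forall i, joins (A i) (e (ordS i)) (e (ordS (ordS i))) /\ on_square_off (A i) (e i)) /\
    \big[addb/false]_i wind (A i) a = true.
Proof.
move=> e_inj er.
have /choice[t tP] i : exists t, 0 <= t < 8 * r /\ e i = perimeter t.
  by have [t] := perimeter_onto (er i); exists t.
have t_neq i j : i != j -> t i != t j.
  by apply: contra_neq => tij; apply: e_inj; rewrite (tP i).2 (tP j).2 tij.
have /choice[A AP] i : exists A, [/\ joins A (e (ordS i)) (e (ordS (ordS i))),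
    on_square_off A (e i) & wind A a = (t (ordS i) <= 3 * r) (+) (t (ordS (ordS i)) <= 3 * r) (+)
      ((t (ordS i) < t i) (+) (t (ordS (ordS i)) < t i))].
  rewrite (tP i).2 !(tP (ordS _)).2; apply: perimeter_route; rewrite ?(tP _).1 ?t_neq //.
    by case: i => -[|[|[|]]].
  by case: i => -[|[|[|]]].
exists A; split=> [i|]; first by have [] := AP i.
under eq_bigr => i _ do have [_ _ ->] := AP i.
rewrite big_split /= (addb_sum_ordS (fun i => t i <= 3 * r)) addFb big_split /=.
rewrite [X in _ (+) X](reindex_inj (@ordS_inj 3)) -big_split /=.
transitivity (\big[addb/false]_(i < 3) true); last by rewrite !big_ord_recl big_ord0.
apply: eq_bigr => i _; have -> : ordS (ordS (ordS i)) = i.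
  by apply: val_inj; case: i => -[|[|[|]]].
by have := t_neq i (ordS i); case: ltgtP => //= _; apply; case: i => -[|[|[|]]].
Qed.

End Square.

(** * Three routes from a point *)

Section Legs.
Variables (R : realType) (a b : R * R) (r rho : R).
Implicit Types (z u e : R * R) (I X Q : set (R * R)) (A E : chain R).

Lemma line_segment_connected (V : normedModType R) (x y : V) :
  connected [set x + t *: (y - x) | t in `[0, 1]].
Proof.
apply: connected_continuous_connected; first exact: segment_connected.
apply: continuous_subspaceT => t; apply: cvgD; first exact: cvg_cst.
by apply: cvgZr_tmp; exact: cvg_id.
Qed.

(* A route from [a] through [u] to [b], cut at its last visit [e] to the square
   of radius [r] around [a]: [I] leads from [a] to [e], [X] from [e] to [u], and
   [Q] extends [X] to [b]. *)
Record leg u e I X Q : Prop := Leg {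
  leg_inner : [/\ closed I, connected I, I a & I e];
  leg_inner_ball : I `<=` ball a rho;
  leg_outer : [/\ connected X, X e, X u & X `<=` Q];
  leg_tail : [/\ closed Q, connected Q & Q b];
  leg_cut : `|e - a| = r;
  leg_tail_outside : forall z, Q z -> z <> e -> r < `|z - a|;
  leg_far : ~ ball a rho u }.

Section ThreeLegs.
Variables (u e : 'I_3 -> R * R) (I X Q : 'I_3 -> set (R * R)) (F : set (R * R)) (p0 : R * R).
Hypotheses (r_gt0 : 0 < r) (r_rho : r < rho).
Hypotheses (legs : forall i, leg (u i) (e i) (I i) (X i) (Q i))
  (legs_apart : forall i j, i != j -> X i `<=` ~` Q j).
Hypotheses (F_connected : connected F) (F_off : forall i, F `<=` ~` (I i `|` Q i))
  (F_closure : forall i, closure F (u i)) (F_p0 : F p0).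

Lemma same_wind_center i j k A : i != j -> i != k -> on_square_off a r A (e i) ->
  same_wind (Q j `|` Q k) A (u i) a.
Proof.
move=> ij ik A_off; pose S := [set a + t *: (e i - a) | t in `[0, 1]].
have [cX Xe Xu XQ] := leg_outer (legs i).
have S_norm z : S z -> r <= `|z - a| -> z = e i.
  move=> [t]; rewrite /= in_itv /= => /andP[t0 t1] <-.
  rewrite addrAC subrr add0r normrZ (leg_cut (legs i)) ger0_norm // ler_pMl // => t_ge1.
  by rewrite (le_anti (_ : t <= 1 <= t)) ?t1 // scale1r addrC subrK.
have Q_norm l z : Q l z -> r <= `|z - a|.
  move=> Qz; have [->|/eqP ze] := eqVneq z (e l); first by rewrite (leg_cut (legs l)).
  exact/ltW/(leg_tail_outside (legs l)).
have eN : (Q j `|` Q k) (e i) -> False by move=> [/(legs_apart ij Xe)|/(legs_apart ik Xe)].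
apply: (@same_wind_connected _ (X i `|` S)).
- apply: connectedU => //; last exact: line_segment_connected.
  exists (e i); split=> //.
  by exists 1; rewrite /= ?in_itv /= ?lexx ?ler01 // scale1r addrC subrK.
- by apply: closedU; [have [] := leg_tail (legs j) | have [] := leg_tail (legs k)].
- move=> z [Xz|Sz] Qz; first by case: Qz; [exact: legs_apart Xz | exact: legs_apart Xz].
  by apply: eN; rewrite -(S_norm z Sz) //; case: Qz => /Q_norm.
- move=> z XSz f fA; apply/negP => /(A_off f z fA)[zr ze]; case: XSz => [/XQ Qz|/S_norm].
    by have := leg_tail_outside (legs i) Qz ze; rewrite zr ltxx.
  by rewrite zr lexx => /(_ isT).
- by left.
- by right; exists 0; rewrite /= ?in_itv /= ?lexx ?ler01 // scale0r addr0.
Qed.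

Lemma same_wind_face i j k : i != j -> i != k ->
  same_wind ((I j `|` Q j) `|` (I k `|` Q k)) [::] (u i) p0.
Proof.
move=> ij ik; set K := _ `|` _; have [_ _ Xu _] := leg_outer (legs i).
have IQ_closed l : closed (I l `|` Q l).
  by apply: closedU; [have [] := leg_inner (legs l) | have [] := leg_tail (legs l)].
have K_closed : closed K by exact: closedU.
have nKu : ~ K (u i).
  have off l : i != l -> ~ (I l `|` Q l) (u i).
    by move=> il [/(leg_inner_ball (legs l))/(leg_far (legs i))|/(legs_apart il Xu)].
  by move=> [/(off j ij)|/(off k ik)].
have no_edge z : {in [::], forall f, ~~ in_bbox f.1 f.2 z} by [].
have /F_closure[y [Fy uy]] := same_wind_near K_closed nKu (no_edge _).
apply: same_wind_trans uy _; apply: (same_wind_connected F_connected K_closed) => // z Fz.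
by move=> [/(F_off Fz)|/(F_off Fz)].
Qed.

Definition leg_chains eps (J C : 'I_3 -> chain R) := forall i,
  [/\ joins (J i) a (e i), fine_in (I i) eps (J i),
      joins (C i) (e i) b & fine_in (Q i) eps (C i)].

Lemma exists_leg_chains eps : 0 < eps -> exists J C, leg_chains eps J C.
Proof.
move=> eps_gt0.
have /choice[J JP] i : exists J, joins J a (e i) /\ fine_in (I i) eps J.
  have [_ cI Ia Ie] := leg_inner (legs i).
  by have [J jJ fJ] := fine_chain cI eps_gt0 Ia Ie; exists J.
have /choice[C CP] i : exists C, joins C (e i) b /\ fine_in (Q i) eps C.
  have [_ cQ Qb] := leg_tail (legs i); have [_ Xe _ XQ] := leg_outer (legs i).
  by have [C jC fC] := fine_chain cQ eps_gt0 (XQ _ Xe) Qb; exists C.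
by exists J, C => i; have [? ?] := JP i; have [? ?] := CP i.
Qed.

Lemma wind_two_legs i j k A : i != j -> i != k -> joins A (e j) (e k) ->
  on_square_off a r A (e i) -> \forall eps \near 0^'+, forall J C, leg_chains eps J C ->
    wind A a (+) (wind (C j) a (+) wind (C k) a) =
    wind (J j ++ C j) p0 (+) wind (J k ++ C k) p0.
Proof.
move=> ij ik jA A_off; near=> eps => J C JC.
have [jJj fJj jCj fCj] := JC j; have [jJk fJk jCk fCk] := JC k.
have center : wind (A ++ C j ++ C k) (u i) = wind (A ++ C j ++ C k) a.
  have /(_ (C j ++ C k)) : forall E, fine_in (Q j `|` Q k) eps E -> cyclic_chain (A ++ E) ->
    wind (A ++ E) (u i) = wind (A ++ E) a by near: eps; exact: same_wind_center.
  apply.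
    by apply: fine_in_cat; [apply: fine_inS fCj | apply: fine_inS fCk] => z; [left | right].
  by move=> f; rewrite !boundary_cat jA jCj jCk; case: (f (e j)) (f (e k)) (f b) => [] [] [].
have face : wind ((J j ++ C j) ++ (J k ++ C k)) (u i) = wind ((J j ++ C j) ++ (J k ++ C k)) p0.
  have : forall E, fine_in ((I j `|` Q j) `|` (I k `|` Q k)) eps E -> cyclic_chain ([::] ++ E) ->
    wind ([::] ++ E) (u i) = wind ([::] ++ E) p0 by near: eps; exact: same_wind_face.
  apply; last exact: joins_cyclic (joins_cat jJj jCj) (joins_cat jJk jCk).
  apply: fine_in_cat; apply: fine_in_cat.
  - by apply: fine_inS fJj => z; do 2!left.
  - by apply: fine_inS fCj => z; left; right.
  - by apply: fine_inS fJk => z; right; left.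
  - by apply: fine_inS fCk => z; do 2!right.
have inner : wind (A ++ J j ++ J k) (u i) = false.
  apply: (@wind_outside_square _ a _ rho); last exact: leg_far.
    by move=> f; rewrite !boundary_cat jA jJj jJk; case: (f (e j)) (f (e k)) (f a) => [] [] [].
  have A_ball z : `|z - a| = r -> ball a rho z by move=> zr; rewrite -ball_normE /= distrC zr.
  move=> f; rewrite !mem_cat => /orP[fA|/orP[/fJj|/fJk] [? ? _]].
  - have ends z : in_bbox f.1 f.2 z -> ball a rho z by move=> /(A_off f z fA)[zr _]; exact: A_ball.
    by split; apply: ends; rewrite /in_bbox !ge_min !le_max !lexx ?orbT.
  - by split; apply: (leg_inner_ball (legs j)).
  - by split; apply: (leg_inner_ball (legs k)).
move: center face inner; rewrite !wind_cat => <- <-.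
by move: (wind A _) (wind (J j) _) (wind (J k) _) (wind (C j) _) (wind (C k) _) => [] [] [] [] [].
Unshelve. all: by end_near. Qed.

Lemma no_three_legs : False.
Proof.
have e_inj : injective e.
  move=> i j eij; apply/eqP; apply: contraT => ij; have [_ Xe _ _] := leg_outer (legs i).
  have [_ Xej _ XQ] := leg_outer (legs j).
  by case: (legs_apart ij Xe); rewrite eij; exact: XQ.
have [A [AP A_odd]] := square_cut r_gt0 e_inj (fun i => leg_cut (legs i)).
have : \forall eps \near 0^'+, forall i J C, leg_chains eps J C ->
    wind (A i) a (+) (wind (C (ordS i)) a (+) wind (C (ordS (ordS i))) a) =
    wind (J (ordS i) ++ C (ordS i)) p0 (+) wind (J (ordS (ordS i)) ++ C (ordS (ordS i))) p0.
  apply: filter_forall => i; have [jA A_off] := AP i.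
  by apply: (wind_two_legs _ _ jA A_off); case: i {jA A_off} => -[|[|[|]]].
move=> near_wind; have [eps [eps_gt0 windP]] := filter_ex (filterI (nbhs_right_gt 0) near_wind).
have [J [C JC]] := exists_leg_chains eps_gt0.
pose W i := wind (J i ++ C i) p0.
have : \big[addb/false]_i (wind (A i) a (+) (wind (C (ordS i)) a (+) wind (C (ordS (ordS i))) a)) =
    \big[addb/false]_i (W (ordS i) (+) W (ordS (ordS i))).
  by apply: eq_bigr => i _; exact: windP.
by rewrite big_split /= A_odd !(addb_sum_ordS (fun i => wind (C i) a), addb_sum_ordS W).
Qed.

End ThreeLegs.
End Legs.

(** * Drawings *)

Section LastVisit.
Variable R : realType.

Lemma last_crossing (f : R -> R) (x y r : R) : x <= y ->
  {within `[x, y], continuous f} -> f x <= r -> r < f y ->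
  exists s, [/\ x <= s <= y, f s = r & forall t, s < t <= y -> r < f t].
Proof.
move=> xy cf fx fy; pose A := `[x, y] `&` f @^-1` [set v | v <= r].
have compactA : compact A.
  have /closed_subspaceP[V clV VE] : closed (f @^-1` [set v | v <= r] : set (subspace `[x, y])).
    by apply: closed_comp => //; exact: closed_le.
  by rewrite /A setIC -VE setIC; apply: compact_closedI => //; exact: segment_compact.
have A_x : A x by split; rewrite //= in_itv /= lexx.
have [s /set_mem[/=]] := compact_EVT_max (ex_intro _ x A_x) compactA
  (continuous_subspaceT (fun=> cvg_id)).
rewrite in_itv /= => /andP[xs sy] fs smax.
have after t : s < t <= y -> r < f t.
  move=> /andP[st ty]; rewrite ltNge; apply/negP => ft; have : t <= s; last by rewrite leNgt st.
  by apply/smax/mem_set; split; rewrite //= in_itv /= ty (le_trans xs) // ltW.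
exists s; rewrite xs sy; split=> //.
have sub : `[s, y] `<=` `[x, y] by move=> t; rewrite /= !in_itv /= => /andP[/(le_trans xs) -> ->].
have [|t] := @IVT _ f s y r sy (continuous_subspaceW sub cf).
  by rewrite ge_min fs le_max (ltW fy) orbT.
rewrite in_itv /= => /andP[st ty] ft; have [->|s_neq_t] := eqVneq s t; first by [].
by have := after t; rewrite ft ltxx lt_neqAle s_neq_t st ty => /(_ isT).
Qed.

Lemma last_visit (V : normedModType R) (alpha : R -> V) (a : V) (rho : R) :
  {within `[0, 1], continuous alpha} -> alpha 0 = a ->
  (forall t, 0 < t <= 1 -> alpha t <> a) -> 0 < rho ->
  \forall r \near 0^'+, exists s, [/\ 0 < s <= 1, `|alpha s - a| = r,
    forall t, s < t <= 1 -> r < `|alpha t - a| & forall t, 0 <= t <= s -> ball a rho (alpha t)].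
Proof.
move=> calpha alpha0 alphaN rho_gt0; pose f t := `|alpha t - a|.
have cf : {within `[0, 1], continuous f}.
  by move=> x; apply: cvg_norm; apply: cvgB; [exact: calpha | exact: cvg_cst].
have f0 : f 0 = 0 by rewrite /f alpha0 subrr normr0.
have [tau /andP[tau_gt0 tau1] f_tau] : exists2 tau, 0 < tau <= 1 &
    forall t, 0 <= t <= tau -> f t < rho.
  have [_ + _] := (continuous_within_itvP f ltr01).1 cf.
  rewrite f0 => /cvgr_lt/(_ rho rho_gt0)[d /= d0 dP].
  exists (Num.min (d / 2) 1); first by rewrite lt_min divr_gt0 // ltr01 ge_min lexx orbT.
  move=> t /andP[t0]; rewrite le_min => /andP[td _].
  have [<-|tn0] := eqVneq 0 t; first by rewrite f0.
  by apply: dP; rewrite /= ?lt_neqAle ?tn0 // sub0r normrN ger0_norm //; lra.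
have sub01 : `[tau, 1] `<=` `[0, 1].
  by move=> t; rewrite /= !in_itv /= => /andP[/(le_trans (ltW tau_gt0)) -> ->].
have [m] := EVT_min tau1 (continuous_subspaceW sub01 cf).
rewrite in_itv /= => /andP[tm m1] fm_min.
have fm_gt0 : 0 < f m.
  by rewrite normr_gt0 subr_eq0; apply/eqP/alphaN; rewrite (lt_le_trans tau_gt0 tm).
near=> r; have r_fm : r < f m by near: r; exact: nbhs_right_lt.
have late t : tau <= t <= 1 -> r < f t.
  by move=> t_late; apply: lt_le_trans (fm_min t _); rewrite ?in_itv.
have [||s [/andP[s0 s1] fs after]] := last_crossing (r := r) ler01 cf; rewrite ?f0 //.
  by apply: late; rewrite tau1 lexx.
exists s; split=> // [|t /andP[t0 ts]].
  rewrite s1 lt_neqAle s0 !andbT; apply/eqP => s_eq0.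
  by move: fs; rewrite -s_eq0 f0; apply/eqP; rewrite eq_sym gt_eqF.
rewrite -ball_normE /= distrC; apply: f_tau; rewrite t0 (le_trans ts) // leNgt; apply/negP => tau_s.
by have := late s; rewrite (ltW tau_s) s1 fs ltxx => /(_ isT).
Unshelve. all: by end_near. Qed.

Lemma curve_piece (V : normedModType R) (alpha : R -> V) (x y x' y' : R) :
  {within `[x, y], continuous alpha} -> x <= x' -> y' <= y ->
  closed (alpha @` `[x', y']) /\ connected (alpha @` `[x', y']).
Proof.
move=> calpha xx' y'y; have sub : `[x', y'] `<=` `[x, y].
  by move=> t; rewrite /= !in_itv /= => /andP[/(le_trans xx') -> /le_trans ->].
have {}calpha := continuous_subspaceW sub calpha; split.
  apply: compact_closed; first exact: norm_hausdorff.
  by apply: continuous_compact calpha _; exact: segment_compact.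
by apply: connected_continuous_connected calpha; exact: segment_connected.
Qed.

Lemma within_continuous_reverse (T : topologicalType) (f : R -> T) :
  {within `[0, 1], continuous f} -> {within `[0, 1], continuous (fun t => f (1 - t))}.
Proof.
have rev01 (t : R) : `[0, 1]%classic t -> `[0, 1]%classic (1 - t) by rewrite /= !in_itv /=; lra.
move=> /subspace_continuousP cf; apply/subspace_continuousP => t t01.
apply: (@cvg_comp _ _ _ (fun t : R => 1 - t) f _ _ _ _ (cf _ (rev01 t t01))) => P nP.
have cvg_rev : (fun t : R => 1 - t) @ t --> 1 - t by apply: cvgB; [exact: cvg_cst | exact: cvg_id].
rewrite -[_ P]/(\forall z \near t, `[0, 1]%classic z -> P (1 - z)).
by near=> z => /rev01; near: z; exact: cvg_rev _ nP.
Unshelve. all: by end_near. Qed.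

Lemma itv01_cases (t : R) : 0 <= t <= 1 -> [\/ t = 0, t = 1 | t \in `]0, 1[].
Proof.
move=> /andP[t0 t1]; have [<-|n0] := eqVneq 0 t; first by constructor 1.
have [->|n1] := eqVneq t 1; first by constructor 2.
by constructor 3; rewrite in_itv /= !lt_neqAle n0 n1 t0.
Qed.

End LastVisit.
Section Drawing.
Variables (R : realType) (G : sgraph) (d : plane_drawing R G).
Implicit Types (u v w : G) (e f : {set G}) (Y : {set G}) (z : R * R).

Local Notation arc := (Defs.arc d).

Definition edge_arc e : set (R * R) := arc e @` `[0, 1].

(* The drawing of [G - Y]. *)
Definition drawn_off Y : set (R * R) := [set pos d w | w in [set w | w \notin Y]] `|`
  \bigcup_(e in [set e | e \in edges G /\ {in e, forall v, v \notin Y}]) edge_arc e.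

Lemma edge_mem u v : adj u v -> [set u; v]%SET \in edges G.
Proof.
move=> uv; rewrite inE; apply/existsP; exists u; apply/existsP; exists v.
by rewrite uv eqxx.
Qed.

Lemma arc_end e t : e \in edges G -> t = 0 \/ t = 1 -> exists2 v, v \in e & arc e t = pos d v.
Proof.
move=> eG t01; have : [set arc e 0; arc e 1] (arc e t) by case: t01 => ->; [left | right].
by rewrite (arc_ends d eG) => -[v /= ve <-]; exists v.
Qed.

Lemma edge_arc_posP e v : e \in edges G -> edge_arc e (pos d v) <-> v \in e.
Proof.
move=> eG; split=> [[t]|ve]; last first.
  have : [set pos d w | w in [set` e]] (pos d v) by exists v.
  by rewrite -(arc_ends d eG) => -[] ->; [exists 0 | exists 1] => //=; rewrite in_itv /= lexx ler01.
rewrite /= in_itv /= => /itv01_cases t01 tv.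
have t01' : t = 0 \/ t = 1 by case: t01 => [||/(arc_avoids_vertices eG)/(_ tv)]; [left | right |].
by have [w we] := arc_end eG t01'; rewrite tv => /pos_inj ->.
Qed.

Lemma edge_arcs_meet e f z : e \in edges G -> f \in edges G -> e <> f ->
  edge_arc e z -> edge_arc f z -> exists v, [/\ v \in e, v \in f & z = pos d v].
Proof.
move=> eG fG ef ez fz.
have vertex v : z = pos d v -> exists v, [/\ v \in e, v \in f & z = pos d v].
  by move=> zv; exists v; split=> //; apply/edge_arc_posP; rewrite -?zv.
have [s s01 sz] := ez; have [t t01 tz] := fz; move: s01 t01; rewrite /= !in_itv /=.
move=> /itv01_cases[s0|s1|si]; last move=> /itv01_cases[t0|t1|ti].
- by have [v _] := arc_end eG (or_introl s0); rewrite sz => /vertex.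
- by have [v _] := arc_end eG (or_intror s1); rewrite sz => /vertex.
- by have [v _] := arc_end fG (or_introl t0); rewrite tz => /vertex.
- by have [v _] := arc_end fG (or_intror t1); rewrite tz => /vertex.
by case: (arcs_disjoint eG fG ef si ti (etrans sz (esym tz))).
Qed.

Lemma edge_arcs_meet_at a u v z : adj a u -> adj a v -> u <> v ->
  edge_arc [set a; u]%SET z -> edge_arc [set a; v]%SET z -> z = pos d a.
Proof.
move=> au av uv uz vz; have ne : [set a; u]%SET <> [set a; v]%SET.
  move=> /setP/(_ u); rewrite !inE eqxx orbT => /esym/orP[]/eqP // ua.
  by rewrite ua adj_irrefl in au.
have [w []] := edge_arcs_meet (edge_mem au) (edge_mem av) ne uz vz.
by rewrite !inE => /orP[/eqP -> //|/eqP ->] /orP[/eqP -> //|/eqP].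
Qed.

Lemma edge_arc_compact e : e \in edges G -> compact (edge_arc e).
Proof.
by move=> eG; apply: continuous_compact; [exact: arc_continuous | exact: segment_compact].
Qed.

Lemma edge_arc_connected e : e \in edges G -> connected (edge_arc e).
Proof.
move=> eG; apply: connected_continuous_connected; first exact: segment_connected.
exact: arc_continuous.
Qed.

Lemma drawn_off_pos Y v : drawn_off Y (pos d v) -> v \notin Y.
Proof.
by case=> [[w /= wY /pos_inj <- //]|[e /= [eG eY] /(edge_arc_posP _ eG)/eY]].
Qed.

Lemma edge_arc_drawn_off e Y z : e \in edges G -> {subset e <= Y} ->
  edge_arc e z -> ~ drawn_off Y z.
Proof.
move=> eG eY ez [[w /= /negP wY wz]|[f /= [fG fY] fz]].
  by apply/wY/eY/edge_arc_posP; rewrite ?wz.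
have ef : e <> f.
  have [v ve] : exists v, v \in e by have [v] := arc_end eG (or_introl (erefl 0)); exists v.
  by move=> E; have := fY v; rewrite -E ve eY // => /(_ isT).
by have [v [/eY vY /fY]] := edge_arcs_meet eG fG ef ez fz; rewrite vY.
Qed.

Lemma drawn_off_sub Y : drawn_off Y `<=` drawing_set d.
Proof. by move=> z [[w _ <-]|[e [eG _] ez]]; [left; exists w | right; exists e]. Qed.

Lemma joined_outside_drawn_off Y u v : u \notin Y -> joined_outside Y u v ->
  exists K : set (R * R),
    [/\ closed K, connected K, K (pos d u), K (pos d v) & K `<=` drawn_off Y].
Proof.
move=> uY /connectP[p pp ->] {v}; elim: p u uY pp => [|w p IH] u uY /=.
  move=> _; exists [set pos d u]; split=> //.
  - by apply: compact_closed; [exact: norm_hausdorff | exact: compact_set1].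
  - exact: connected1.
  - by move=> z ->; left; exists u.
move=> /andP[/and3P[_ wY uw] /(IH _ wY)[K [clK cK Kw Kl KY]]].
have eG := edge_mem uw; set e := [set u; w]%SET in eG *.
exists (edge_arc e `|` K); split.
- by apply: closedU => //; apply: compact_closed; [exact: norm_hausdorff | exact: edge_arc_compact].
- apply: connectedU (edge_arc_connected eG) cK.
  by exists (pos d w); split => //; apply/(edge_arc_posP _ eG); rewrite !inE eqxx orbT.
- by left; apply/(edge_arc_posP _ eG); rewrite !inE eqxx.
- by right.
- move=> z [ez|/KY //]; right; exists e => //=; split=> //.
  by move=> x; rewrite !inE => /orP[] /eqP ->.
Qed.

Lemma arc_from u v : adj u v -> exists alpha : R -> R * R,
  [/\ {within `[0, 1], continuous alpha}, alpha 0 = pos d u, alpha 1 = pos d v,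
      forall t, 0 < t <= 1 -> alpha t <> pos d u & alpha @` `[0, 1] `<=` edge_arc [set u; v]%SET].
Proof.
move=> uv; have eG := edge_mem uv; set e := [set u; v]%SET in eG *.
have arcI (s t : R) : 0 <= s <= 1 -> 0 <= t <= 1 -> arc e s = arc e t -> s = t.
  by move=> s01 t01; apply: (arc_inj eG); rewrite in_itv.
have [x xe e0] := arc_end eG (or_introl (erefl 0)).
have [y ye e1] := arc_end eG (or_intror (erefl 1)).
have xy : x <> y.
  move=> E; have := arcI 0 1; rewrite e0 e1 E !lexx ler01 => /(_ isT isT erefl)/eqP.
  by rewrite eq_sym oner_eq0.
have [[xu yv]|[xv yu]] : (x = u /\ y = v) \/ (x = v /\ y = u).
  by move: xe ye xy; rewrite !inE => /orP[] /eqP -> /orP[] /eqP ->; by [left | right | case].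
- exists (arc e); split=> //; rewrite ?e0 ?e1 ?xu ?yv //; first exact: arc_continuous.
  by move=> t t01; rewrite -xu -e0 => /arcI E; have : t = 0 by [apply: E; lra]; lra.
- exists (fun t => arc e (1 - t)); split; rewrite ?subr0 ?subrr ?e0 ?e1 ?xv ?yu //.
  + exact/within_continuous_reverse/arc_continuous.
  + by move=> t t01; rewrite -yu -e1 => /arcI E; have : 1 - t = 1 by [apply: E; lra]; lra.
  + by move=> z [t t01 <-]; exists (1 - t) => //; move: t01; rewrite /= !in_itv /=; lra.
Qed.

Section Face.
Variable F : set (R * R).
Hypotheses (F_connected : connected F) (F_off : F `<=` ~` drawing_set d)
  (F_vertices : forall v, closure F (pos d v)).

Lemma leg_near a b u Y (rho : R) : adj a u -> a \in Y -> u \notin Y -> joined_outside Y u b ->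
  0 < rho <= `|pos d u - pos d a| ->
  \forall r \near 0^'+, exists c I X Q, [/\ leg (pos d a) (pos d b) r rho (pos d u) c I X Q,
    I `<=` edge_arc [set a; u]%SET, X `<=` edge_arc [set a; u]%SET `\ pos d a &
    Q `<=` X `|` drawn_off Y].
Proof.
move=> au aY uY /(joined_outside_drawn_off uY)[K [clK cK Ku Kb KY]] /andP[rho_gt0 rho_u].
have [alpha [calpha alpha0 alpha1 alphaN alpha_au]] := arc_from au.
have nKa : ~ K (pos d a) by move=> /KY/drawn_off_pos; rewrite aY.
have K_far : \forall r \near 0^'+, forall z, K z -> r < `|z - pos d a|.
  have /nbhs_ballP[q /= q_gt0 qK] : nbhs (pos d a) (~` K).
    by apply: open_nbhs_nbhs; split; [exact: closed_openC |].
  near=> r => z Kz; apply: lt_le_trans (_ : q <= _); first by near: r; exact: nbhs_right_lt.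
  by rewrite leNgt; apply/negP => zq; apply: (qK z) => //; rewrite -ball_normE /= distrC.
near=> r; have r_K : forall z, K z -> r < `|z - pos d a| by near: r.
have [s [/andP[s_gt0 s1] s_norm after before]] : exists s, [/\ 0 < s <= 1,
    `|alpha s - pos d a| = r, forall t, s < t <= 1 -> r < `|alpha t - pos d a| &
    forall t, 0 <= t <= s -> ball (pos d a) rho (alpha t)].
  by near: r; exact: last_visit.
have [s0 le11] : 0 <= s /\ (1 : R) <= 1 by rewrite ltW ?lexx.
have [closed_in connected_in] := curve_piece calpha (lexx 0) s1.
have [closed_out connected_out] := curve_piece calpha s0 le11.
exists (alpha s), (alpha @` `[0, s]), (alpha @` `[s, 1]), (alpha @` `[s, 1] `|` K).
have out_s : (alpha @` `[s, 1]) (alpha s) by exists s; rewrite //= in_itv /= lexx.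
have out_u : (alpha @` `[s, 1]) (pos d u) by exists 1; rewrite //= in_itv /= lexx s1.
split.
- split=> //.
  + by split=> //; [exists 0 | exists s]; rewrite //= in_itv /= lexx s0.
  + by move=> z [t]; rewrite /= in_itv /= => t0s <-; exact: before.
  + split; [exact: closedU | | by right].
    by apply: connectedU => //; exists (pos d u).
  + move=> z [[t]|/r_K //].
    rewrite /= in_itv /= => /andP[st t1] <- ts; apply: after.
    by rewrite t1 lt_neqAle st !andbT; apply/eqP => E; apply: ts; rewrite E.
  + by rewrite -ball_normE /= distrC => /lt_le_trans/(_ rho_u); rewrite ltxx.
- by move=> z [t ts <-]; apply: alpha_au; exists t => //; move: ts; rewrite /= !in_itv /=; lra.
- move=> z [t ts <-]; split; last by apply: (alphaN t); move: ts; rewrite /= in_itv /=; lra.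
  by apply: alpha_au; exists t => //; move: ts; rewrite /= !in_itv /=; lra.
- by move=> z [|/KY]; [left | right].
Unshelve. all: by end_near. Qed.

Lemma drawing_theta_free : theta_free G.
Proof.
move=> a b t [t_inj at_adj routes].
have t_avoided i j : i != j -> t i \in avoided a t j.
  by move=> ij; apply/finset.setU1P; right; apply/imsetP; exists i; rewrite ?inE.
have t_notin i : t i \notin avoided a t i.
  rewrite !inE negb_or; apply/andP; split.
    by apply: contraTneq (at_adj i) => ->; rewrite adj_irrefl.
  by apply/imsetP => -[j]; rewrite !inE => /eqP ji /t_inj/esym.
have near_rho : \forall rho \near 0^'+, forall i, rho <= `|pos d (t i) - pos d a|.
  apply: filter_forall => i; apply: nbhs_right_le; rewrite normr_gt0 subr_eq0.
  by apply: contraTneq (at_adj i) => /pos_inj ->; rewrite adj_irrefl.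
have [rho [rho_gt0 rhoP]] := filter_ex (filterI (nbhs_right_gt 0) near_rho).
have near_legs : \forall r \near 0^'+, forall i, exists c I X Q,
    [/\ leg (pos d a) (pos d b) r rho (pos d (t i)) c I X Q,
      I `<=` edge_arc [set a; t i]%SET, X `<=` edge_arc [set a; t i]%SET `\ pos d a &
      Q `<=` X `|` drawn_off (avoided a t i)].
  by apply: filter_forall => i; apply: leg_near; rewrite ?rho_gt0 ?rhoP // !inE eqxx.
have [r [[r_gt0 r_rho] legsP]] := filter_ex (filterI (filterI (nbhs_right_gt 0)
  (nbhs_right_lt rho_gt0)) near_legs).
have /choice[c /choice[I /choice[X /choice[Q {}legsP]]]] := legsP.
have [p0 [Fp0 _]] := @F_vertices a _ filterT.
have legs i : leg (pos d a) (pos d b) r rho (pos d (t i)) (c i) (I i) (X i) (Q i).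
  by have [] := legsP i.
apply: (no_three_legs r_gt0 r_rho legs _ F_connected _ _ Fp0) => // [i j ij z Xz Qz|i z Fz IQz].
  have [_ _ /(_ z Xz)[z_ai z_neq_a] _] := legsP i; have [_ _ XP /(_ z Qz)[|]] := legsP j.
    move=> /XP[z_aj _]; apply: z_neq_a; apply: (edge_arcs_meet_at _ _ _ z_ai z_aj) => //.
    by move=> /t_inj/eqP; exact/negP.
  apply: edge_arc_drawn_off z_ai; first exact: edge_mem.
  by move=> v; rewrite !inE => /orP[] /eqP ->; rewrite ?eqxx // -in_setU1 t_avoided.
have [_ IP XP QP] := legsP i; have edge_drawn : edge_arc [set a; t i]%SET `<=` drawing_set d.
  by move=> w w_ai; right; exists [set a; t i]%SET => //; exact: edge_mem.
apply: (F_off Fz); case: IQz => [/IP/edge_drawn //|/QP[/XP[/edge_drawn //]|]].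
exact: drawn_off_sub.
Qed.

End Face.
End Drawing.

Lemma outerplanar_theta_free (R : realType) (G : sgraph) : outerplanar R G -> theta_free G.
Proof.
move=> [d [F [[p p_off ->] _ F_vertices]]]; apply: (drawing_theta_free (d := d)) F_vertices.
  exact: component_connected.
exact: connected_component_sub.
Qed.

End PlaneTopology.

(** * The bound on the chromatic number *)

Lemma leq_max_degree (G : sgraph) (v : G) : #|neighbours v| <= max_degree G.
Proof. exact: (leq_bigmax (F := fun v : G => #|neighbours v|)). Qed.

Lemma girth_triangle_free (G : sgraph) (g : nat) : is_girth G g -> 3 < g -> triangle_free G.
Proof.
move=> [_ g_min] g_gt3 a b u ab bu au.
have adj_neq (x y : G) : adj x y -> x != y by apply: contraTneq => ->; rewrite adj_irrefl.
suff abu : graph_cycle [:: a; b; u] by have := g_min 3 (ex_intro2 _ _ _ abu erefl); lia.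
by split; rewrite // /ucycle /= ab bu adj_sym au !inE negb_or !adj_neq.
Qed.

Lemma exists_least (P : nat -> Prop) (n : nat) : P n -> exists2 k, is_least P k & k <= n.
Proof.
move=> Pn; have exP : exists m, `[< P m >] by exists n; apply/asboolP.
have [k /asboolP Pk k_min] := ex_minnP exP.
by exists k; [split=> // m Pm | ]; apply: k_min; apply/asboolP.
Qed.

Theorem theorem18 (R : realType) (G : sgraph) (Delta g : nat)
    (h2conn : k_connected 2 G) (houter : outerplanar R G)
    (hDelta : max_degree G = Delta) (hDelta4 : (4 <= Delta)%N)
    (hgirth : is_girth G g) (hgirth4 : (4 <= g)%N) :
  exists2 k : nat, is_chi_vi G 1 k & (k <= Delta + 3)%N.
Proof.
have no_theta := outerplanar_theta_free houter.
have no_triangle := girth_triangle_free hgirth hgirth4.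
have degDelta (v : G) : #|neighbours v| <= Delta by rewrite -hDelta leq_max_degree.
have [s [_ s_cycle] s_all] : exists2 s : seq G, graph_cycle s & forall v, v \in s.
  by apply: two_connected_hamiltonian => //; have [[s ? _] _] := hgirth; exists s.
have s_noncrossing := theta_free_noncrossing no_theta no_triangle s_cycle.
have [c [d cd]] := vi_pair_noncrossing_cycle degDelta (ltnW hDelta4) (leqnn (Delta + 3))
  no_triangle s_cycle s_noncrossing.
rewrite (_ : [set v in s]%SET = [set: G]%SET) in cd; last by apply/setP => v; rewrite !inE s_all.
exact: (exists_least (vi_pair_coloring cd)).
Qed.
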